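(* (1) For every $u\in\mathbb{L}^4$ with $\langle u,u\rangle=-1$, $u_0<0$, and every real $r>0$, the surface $$\mathbb{S}^2 (u,r)=\big\{x\in \mathbb{L}^4 : \langle x, x\rangle =0,\ \langle u, x\rangle = r \big\}$$ is a totally umbilical spacelike surface in $\mathbb{L}^4$ contained in $\Lambda^+$, with constant Gauss curvature $1/r^2$. (2) Conversely, if $\psi : \mathbb{S}^{2}\rightarrow \mathbb{L}^4$ is a totally umbilical spacelike immersion which factors through the future lightcone $\Lambda^{+}$, i.e. $\psi(\mathbb{S}^2)\subset\Lambda^+$, then there exist $u\in\mathbb{L}^4$ with $\langle u,u\rangle=-1$, $u_0<0$, and $r>0$ such that $\psi(\mathbb{S}^{2})=\mathbb{S}^{2}(u,r)$; here $r$ is determined by $K=1/r^2$, where $K$ is the (constant) Gauss curvature of the induced metric.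
   Context: $\mathbb{L}^4$ is Lorentz-Minkowski spacetime: $\mathbb{R}^4$ with the metric $\langle\,,\,\rangle=-(dx_0)^2+(dx_1)^2+(dx_2)^2+(dx_3)^2$. $\mathbb{S}^2$ is the $2$-sphere as a smooth manifold. A smooth immersion of a surface into $\mathbb{L}^4$ is spacelike if the induced metric is Riemannian. $\Lambda^+=\{v\in\mathbb{L}^4:\langle v,v\rangle=0,\ v_0>0\}$. Totally umbilical means $\mathrm{II}(X,Y)=\langle X,Y\rangle\mathbf{H}$ for all tangent $X,Y$ (equivalently every shape operator is a pointwise multiple of the identity), where $\mathrm{II}$ is the second fundamental form (the normal part of $\overline{\nabla}_XY$, $\overline\nabla$ the flat connection of $\mathbb{L}^4$) and $\mathbf{H}=\frac12\mathrm{tr}_{\langle\,,\,\rangle}\mathrm{II}$. *)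

(* Defs.v *)
From mathcomp Require Export all_boot all_order all_algebra.
From mathcomp Require Export all_classical all_reals all_analysis.

Set Implicit Arguments.
Unset Strict Implicit.
Unset Printing Implicit Defensive.

Export Order.TTheory GRing.Theory Num.Theory.
Export numFieldNormedType.Exports.

Local Open Scope classical_set_scope.
Local Open Scope ring_scope.

Section Smooth.
Variables (R : realType) (m n : nat).

(* f is of class C^k on the open set U. *)
Fixpoint Ck_on (k : nat) (U : set 'rV[R]_m) (f : 'rV[R]_m -> 'rV[R]_n) : Prop :=
  match k with
  | 0 => forall p, U p -> {for p, continuous f}
  | k'.+1 => (forall p, U p -> differentiable f p) /\
             (forall v, Ck_on k' U ('D_v f))
  end.

Definition smooth_on (U : set 'rV[R]_m) (f : 'rV[R]_m -> 'rV[R]_n) : Prop :=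
  forall k, Ck_on k U f.

Definition immersive_on (U : set 'rV[R]_m) (f : 'rV[R]_m -> 'rV[R]_n) : Prop :=
  forall p, U p -> injective ('d f p).

End Smooth.

Section RegularSurface.
Variables (R : realType) (n : nat).
Implicit Types (S : set 'rV[R]_n) (U : set 'rV[R]_2).

(* Local parametrization (inverse of a chart) of the subset S of R^n. The last
   clause, together with continuity and injectivity, says that phi is a
   homeomorphism from U onto a relatively open subset of S. *)
Definition local_param S U (phi : 'rV[R]_2 -> 'rV[R]_n) : Prop :=
  [/\ open U, smooth_on U phi, immersive_on U phi, set_inj U phi &
      forall V, open V -> V `<=` U ->
        exists2 W, open W & phi @` V = S `&` W].

Definition regular_surface S : Prop :=
  forall p, S p -> exists U phi, local_param S U phi /\ (phi @` U) p.

End RegularSurface.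

Section LorentzMinkowski.
Variable R : realType.
Implicit Types (x y u v w : 'rV[R]_4) (r : R).

(* Coordinates x_0, ..., x_3, with x_0 the timelike one. *)
Definition lorentz x y : R :=
  - (x ord0 ord0 * y ord0 ord0)
  + \sum_(i < 3) x ord0 (lift ord0 i) * y ord0 (lift ord0 i).

Definition future_lightcone : set 'rV[R]_4 :=
  [set v | lorentz v v = 0 /\ 0 < v ord0 ord0].

Definition lightcone_sphere u r : set 'rV[R]_4 :=
  [set x | lorentz x x = 0 /\ lorentz u x = r].

Definition unit_sphere2 : set 'rV[R]_3 :=
  [set x | \sum_(i < 3) x ord0 i ^+ 2 = 1].

End LorentzMinkowski.

(* Geometry of a parametrized piece of surface X : U -> L^4, U open in R^2. *)
Section Parametrized.
Variables (R : realType) (X : 'rV[R]_2 -> 'rV[R]_4).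
Implicit Types (p v w : 'rV[R]_2) (i j k l : 'I_2).

Definition coord_vec i : 'rV[R]_2 := delta_mx ord0 i.

Definition partial i p : 'rV[R]_4 := 'D_(coord_vec i) X p.

Definition induced_metric p v w : R := lorentz ('D_v X p) ('D_w X p).

Definition metric_mx p : 'M[R]_2 :=
  \matrix_(i, j) induced_metric p (coord_vec i) (coord_vec j).

Definition inv_metric p : 'M[R]_2 := invmx (metric_mx p).

(* Component of z orthogonal to the tangent plane dX_p(R^2): the subtracted
   term is the tangential projection g^{kl} <z, X_k> X_l. *)
Definition normal_part p (z : 'rV[R]_4) : 'rV[R]_4 :=
  z - \sum_k \sum_l
        (inv_metric p k l * lorentz z (partial k p)) *: partial l p.

(* II(dX v, dX w): extending v and w by constant coefficients on U, the flat
   connection gives \bar\nabla_{dX v} (dX w) = D_v (D_w X). *)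
Definition second_form p v w : 'rV[R]_4 := normal_part p ('D_v ('D_w X) p).

Definition mean_curvature_vec p : 'rV[R]_4 :=
  2^-1 *: \sum_i \sum_j
            inv_metric p i j *: second_form p (coord_vec i) (coord_vec j).

(* Christoffel symbol \Gamma^k_{ij} of the induced metric. *)
Definition christoffel k i j p : R :=
  2^-1 * \sum_l inv_metric p k l *
    ('D_(coord_vec i) (fun q => metric_mx q j l) p
     + 'D_(coord_vec j) (fun q => metric_mx q i l) p
     - 'D_(coord_vec l) (fun q => metric_mx q i j) p).

(* Component along \partial_m of
   R(\partial_i, \partial_j) \partial_k
     = \nabla_i \nabla_j \partial_k - \nabla_j \nabla_i \partial_k. *)
Definition riemann m i j k p : R :=
  'D_(coord_vec i) (christoffel m j k) p
  - 'D_(coord_vec j) (christoffel m i k) p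
  + \sum_l (christoffel l j k p * christoffel m i l p
            - christoffel l i k p * christoffel m j l p).

(* Intrinsic (sectional) curvature
   <R(\partial_0, \partial_1) \partial_1, \partial_0> / det g. *)
Definition gauss_curvature p : R :=
  (\sum_m riemann m 0 1 1 p * metric_mx p m 0) / \det (metric_mx p).

Definition riemannian_on (U : set 'rV[R]_2) : Prop :=
  forall p, U p -> forall v, v != 0 -> 0 < induced_metric p v v.

Definition umbilical_on (U : set 'rV[R]_2) : Prop :=
  forall p, U p -> forall v w,
    second_form p v w = induced_metric p v w *: mean_curvature_vec p.

End Parametrized.

(* Maps psi : S -> L^4 from a regular surface S of R^n; all the notions below
   only involve the restriction of psi to S. A subset S of L^4 is a surface of
   L^4 through the inclusion, i.e. psi = id. *)
Section MapsFromSurface.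
Variables (R : realType) (n : nat).
Variables (S : set 'rV[R]_n) (psi : 'rV[R]_n -> 'rV[R]_4).

Definition smooth_immersion : Prop :=
  forall U phi, local_param S U phi ->
    smooth_on U (psi \o phi) /\ immersive_on U (psi \o phi).

Definition spacelike_immersion : Prop :=
  smooth_immersion /\
  forall U phi, local_param S U phi -> riemannian_on (psi \o phi) U.

Definition totally_umbilical : Prop :=
  forall U phi, local_param S U phi -> umbilical_on (psi \o phi) U.

Definition constant_gauss_curvature (K : R) : Prop :=
  forall U phi, local_param S U phi ->
    forall p, U p -> gauss_curvature (psi \o phi) p = K.

End MapsFromSurface.

(* Main.v *)
(* On a spacelike patch X of the lightcone, <X, X> = 0 makes X normal and gives
   <II(v, w), X> = - <v, w>.  If X is umbilical with mean curvature vector H,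
   then <H, X> = -1, and the Codazzi equation forces <H, H> to be a constant k
   and dH = - k dX; so c = H + k X is constant and the patch lies in the
   hyperplane <c, x> = -1, with <c, c> = - k.  Conversely every spacelike patch
   of the lightcone inside such a hyperplane has II = <,> (c - k X), whence it is
   umbilical, and the Gauss equation gives K = k; for c = - u / r this is a patch
   of the sphere S^2(u, r).

   Compactness enters only through the first-order condition at a maximum of
   <a, psi> on the sphere.  There a is a combination of psi and c, so that
   <a, a> = k m^2 - 2 <a, c> m with m = <a, psi>.  A spacelike a orthogonal to c
   excludes k <= 0.  When a = y is a point of S^2(u, r), the critical values are
   0, attained only where psi = y, and - 2 / k; as <y, psi> is not constant, its
   maximum is 0, and psi is onto. *)

From HB Require Import structures.
Require Import Defs.
From mathcomp Require Import ring lra.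

Set Implicit Arguments.
Unset Strict Implicit.
Unset Printing Implicit Defensive.

Local Open Scope classical_set_scope.
Local Open Scope ring_scope.

(** * The Lorentz form *)

(** The geometric notions quantify over all local parametrizations, so part (1) is proved for an
    arbitrary one. In part (2) the umbilical equations are integrated in a single stereographic
    chart: its domain is the whole plane, so vanishing partial derivatives give constants along
    coordinate lines, and continuity carries [<c, psi> = -1] over to the missing pole. The mean
    curvature vector is not known to be differentiable beforehand; writing it as the quotient of
    [II(X_0, X_0)] by [g_00] shows that it is. Vector identities are checked by pairing with a
    frame: the two tangent vectors, the null vector [X], and a normal vector [c] with [<c, X> = -1].
    Surjectivity comes from linear algebra at critical points rather than from the image being open
    and closed. *)

Lemma sum_ord2 (V : nmodType) (F : 'I_2 -> V) : \sum_i F i = F 0 + F 1.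
Proof.
rewrite !big_ord_recl big_ord0 addr0; congr (F _ + F _); exact: val_inj.
Qed.

Section LorentzForm.
Variable R : realType.
Implicit Types (a : R) (x y z u v w n c : 'rV[R]_4).

Lemma lorentzE x y : lorentz x y =
  - (x ord0 0 * y ord0 0) + x ord0 1 * y ord0 1
  + x ord0 2%:R * y ord0 2%:R + x ord0 3%:R * y ord0 3%:R.
Proof.
have e1 : lift ord0 0 = 1 :> 'I_4 by apply: val_inj.
have e2 : lift ord0 1 = 2%:R :> 'I_4 by apply: val_inj.
have e3 : lift ord0 2%:R = 3%:R :> 'I_4 by apply: val_inj.
rewrite /lorentz !big_ord_recl big_ord0 addr0 !addrA.
have -> : lift ord0 ord0 = 1 :> 'I_3 by apply: val_inj.
have -> : lift ord0 (lift ord0 ord0) = 2%:R :> 'I_3 by apply: val_inj.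
by rewrite e1 e2 e3.
Qed.

Lemma lorentzC x y : lorentz x y = lorentz y x.
Proof. by rewrite !lorentzE; ring. Qed.

Lemma lorentzDl x y z : lorentz (x + y) z = lorentz x z + lorentz y z.
Proof. by rewrite !lorentzE !mxE; ring. Qed.

Lemma lorentzDr x y z : lorentz x (y + z) = lorentz x y + lorentz x z.
Proof. by rewrite !lorentzE !mxE; ring. Qed.

Lemma lorentzZl a x y : lorentz (a *: x) y = a * lorentz x y.
Proof. by rewrite !lorentzE !mxE; ring. Qed.

Lemma lorentzZr a x y : lorentz x (a *: y) = a * lorentz x y.
Proof. by rewrite !lorentzE !mxE; ring. Qed.

Lemma lorentzNl x y : lorentz (- x) y = - lorentz x y.
Proof. by rewrite !lorentzE !mxE; ring. Qed.

Lemma lorentzNr x y : lorentz x (- y) = - lorentz x y.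
Proof. by rewrite !lorentzE !mxE; ring. Qed.

Lemma lorentz0r x : lorentz x 0 = 0.
Proof. by rewrite !lorentzE !mxE; ring. Qed.

Lemma lorentz0l x : lorentz 0 x = 0.
Proof. by rewrite lorentzC lorentz0r. Qed.

Definition lorentz_lin := (lorentzDl, lorentzDr, lorentzZl, lorentzZr,
  lorentzNl, lorentzNr, lorentz0l, lorentz0r).

Lemma lorentz_delta x i : x ord0 i =
  (if i == 0 then -1 else 1) * lorentz x (delta_mx ord0 i).
Proof.
rewrite lorentzE !mxE !eqxx /=.
case: i => -[|[|[|[|//]]]] Hi /=; rewrite ?mulr0 ?mulr1 ?addr0 ?add0r ?oppr0 ?mulN1r ?mul1r ?opprK;
  rewrite ?addr0 ?add0r ?opprK; congr (x _ _); exact: val_inj.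
Qed.

Lemma lorentz_nondeg n : (forall z, lorentz n z = 0) -> n = 0.
Proof.
move=> h; apply/rowP => i; rewrite mxE -[LHS]/(n 0 i) (_ : 0 = ord0) //.
by rewrite lorentz_delta h mulr0.
Qed.

(* The four vectors [w0], [w1], [x], [c] have an invertible Gram matrix, hence
   form a basis of L^4. *)
Lemma frame_orthogonal_eq0 x c w0 w1 n :
  lorentz x x = 0 -> lorentz c x = -1 ->
  lorentz w0 x = 0 -> lorentz w1 x = 0 -> lorentz w0 c = 0 -> lorentz w1 c = 0 ->
  lorentz w0 w0 * lorentz w1 w1 - lorentz w0 w1 * lorentz w1 w0 != 0 ->
  lorentz n x = 0 -> lorentz n c = 0 -> lorentz n w0 = 0 -> lorentz n w1 = 0 ->
  n = 0.
Proof.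
move=> xx cx w0x w1x w0c w1c gram nx nc nw0 nw1.
pose A : 'M[R]_4 := \matrix_(i < 4)
  (if i == 0 then x else if i == 1 then c else if i == 2%:R then w0 else w1).
have rowsA (v : 'rV[R]_4) : v *m A =
    v ord0 0 *: x + v ord0 1 *: c + v ord0 2%:R *: w0 + v ord0 3%:R *: w1.
  rewrite mulmx_sum_row !big_ord_recl big_ord0 addr0 !rowK /= !addrA.
  by congr (v _ _ *: _ + v _ _ *: _ + v _ _ *: _ + v _ _ *: _); apply: val_inj.
have freeA : row_free A.
  apply: inj_row_free => v; rewrite rowsA; set s := _ + _ => s0.
  (* Pairing the relation with [x] isolates the coefficient of [c], and then pairing with [c]
     isolates that of [x]. The remaining 2x2 system has determinant [gram] and is solved by Cramer's
     rule. *)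
  have px : v ord0 1 = 0.
    have : lorentz s x = 0 by rewrite s0 lorentz0l.
    rewrite /s !lorentz_lin xx cx w0x w1x; lra.
  have pc : v ord0 0 = 0.
    have : lorentz s c = 0 by rewrite s0 lorentz0l.
    rewrite /s !lorentz_lin (lorentzC x) cx w0c w1c px; lra.
  have p0 : lorentz s w0 = 0 by rewrite s0 lorentz0l.
  have p1 : lorentz s w1 = 0 by rewrite s0 lorentz0l.
  have {}p0 : v ord0 2%:R * lorentz w0 w0 + v ord0 3%:R * lorentz w1 w0 = 0.
    by move: p0; rewrite /s !lorentz_lin px pc !mul0r !add0r.
  have {}p1 : v ord0 2%:R * lorentz w0 w1 + v ord0 3%:R * lorentz w1 w1 = 0.
    by move: p1; rewrite /s !lorentz_lin px pc !mul0r !add0r.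
  have q2 : v ord0 2%:R = 0.
    apply: (mulIf gram); rewrite mul0r.
    transitivity (lorentz w1 w1 * (v ord0 2%:R * lorentz w0 w0 + v ord0 3%:R * lorentz w1 w0)
      - lorentz w1 w0 * (v ord0 2%:R * lorentz w0 w1 + v ord0 3%:R * lorentz w1 w1)).
      by ring.
    by rewrite p0 p1 !mulr0 subr0.
  have q3 : v ord0 3%:R = 0.
    apply: (mulIf gram); rewrite mul0r.
    transitivity (lorentz w0 w0 * (v ord0 2%:R * lorentz w0 w1 + v ord0 3%:R * lorentz w1 w1)
      - lorentz w0 w1 * (v ord0 2%:R * lorentz w0 w0 + v ord0 3%:R * lorentz w1 w0)).
      by ring.
    by rewrite p0 p1 !mulr0 subr0.
  apply/rowP => i; rewrite mxE.
  case: i => -[|[|[|[|//]]]] Hi; [rewrite -pc|rewrite -px|rewrite -q2|rewrite -q3];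
    congr (v _ _); exact: val_inj.
apply: lorentz_nondeg => z.
have : (z <= A)%MS by rewrite (submx_full _) // row_full_unit -row_free_unit.
case/submxP => v ->; rewrite rowsA !lorentz_lin nx nc nw0 nw1; ring.
Qed.

(** Write [x'], [y'] for the spatial parts. The hypotheses say [x0^2 = |x'|^2] and [x0 y0 = x'.y'],
    so the left side is [|x'|^2 |y'|^2 - (x'.y')^2], and Lagrange's identity turns it into a sum of
    squared minors. *)
Lemma null_orthogonal_cross x y :
  lorentz x x = 0 -> lorentz x y = 0 ->
  (x ord0 0) ^+ 2 * lorentz y y =
  (x ord0 1 * y ord0 2%:R - x ord0 2%:R * y ord0 1) ^+ 2 +
  (x ord0 1 * y ord0 3%:R - x ord0 3%:R * y ord0 1) ^+ 2 +
  (x ord0 2%:R * y ord0 3%:R - x ord0 3%:R * y ord0 2%:R) ^+ 2.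
Proof.
rewrite !lorentzE.
set x0 := x ord0 0; set x1 := x ord0 1; set x2 := x ord0 2%:R; set x3 := x ord0 3%:R.
set y0 := y ord0 0; set y1 := y ord0 1; set y2 := y ord0 2%:R; set y3 := y ord0 3%:R.
move=> xx xy.
have e1 : x0 * x0 = x1 * x1 + x2 * x2 + x3 * x3 by lra.
have e2 : x0 * y0 = x1 * y1 + x2 * y2 + x3 * y3 by lra.
transitivity ((x0 * x0) * (y1 * y1 + y2 * y2 + y3 * y3) - (x0 * y0) * (x0 * y0)); first by ring.
by rewrite e2 e1; ring.
Qed.

Lemma null_orthogonal_ge0 x y :
  lorentz x x = 0 -> x ord0 0 != 0 -> lorentz x y = 0 -> 0 <= lorentz y y.
Proof.
move=> xx x0 xy; rewrite -(pmulr_rge0 _ (_ : 0 < (x ord0 0) ^+ 2)); last first.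
  by rewrite exprn_even_gt0 // x0 orbT.
by rewrite null_orthogonal_cross // !addr_ge0 // sqr_ge0.
Qed.

(** The squared minors of [null_orthogonal_cross] now sum to zero, so the spatial parts are
    proportional; the ratio is read off the time coordinates. *)
Lemma null_orthogonal_collinear x y :
  lorentz x x = 0 -> x ord0 0 != 0 -> lorentz x y = 0 -> lorentz y y = 0 ->
  y = (y ord0 0 / x ord0 0) *: x.
Proof.
move=> xx x0n xy yy; have := null_orthogonal_cross xx xy; rewrite yy mulr0.
move: xx xy x0n; rewrite !lorentzE.
set x0 := x ord0 0; set x1 := x ord0 1; set x2 := x ord0 2%:R; set x3 := x ord0 3%:R.
set y0 := y ord0 0; set y1 := y ord0 1; set y2 := y ord0 2%:R; set y3 := y ord0 3%:R.
move=> xx xy x0n /esym/eqP.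
rewrite !paddr_eq0 ?addr_ge0 ?sqr_ge0 // !sqrf_eq0.
case/andP => /andP[/eqP a /eqP b] /eqP d.
have e1 : x0 * x0 = x1 * x1 + x2 * x2 + x3 * x3 by lra.
have e2 : x0 * y0 = x1 * y1 + x2 * y2 + x3 * y3 by lra.
(* Clearing denominators with [x0^2] makes each coordinate a polynomial identity; after [e1] and
   [e2], its two sides differ by a combination of the vanishing minors. *)
have h (s t : R) : x0 * x0 * t = x0 * y0 * s -> t = y0 / x0 * s.
  move=> st; apply: (mulfI x0n); apply: (mulfI x0n).
  by rewrite !mulrA st; field.
have k0 : y0 = y0 / x0 * x0 by rewrite divfK.
have k1 : y1 = y0 / x0 * x1.
  apply: h; rewrite e1 e2; apply/eqP; rewrite -subr_eq0; apply/eqP.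
  by transitivity (- x2 * (x1 * y2 - x2 * y1) - x3 * (x1 * y3 - x3 * y1)); [ring|rewrite a b; ring].
have k2 : y2 = y0 / x0 * x2.
  apply: h; rewrite e1 e2; apply/eqP; rewrite -subr_eq0; apply/eqP.
  by transitivity (x1 * (x1 * y2 - x2 * y1) - x3 * (x2 * y3 - x3 * y2)); [ring|rewrite a d; ring].
have k3 : y3 = y0 / x0 * x3.
  apply: h; rewrite e1 e2; apply/eqP; rewrite -subr_eq0; apply/eqP.
  by transitivity (x1 * (x1 * y3 - x3 * y1) + x2 * (x2 * y3 - x3 * y2)); [ring|rewrite b d; ring].
apply/rowP => i; rewrite !mxE.
case: i => -[|[|[|[|//]]]] Hi.
- by rewrite (_ : Ordinal Hi = 0) //; exact: val_inj.
- by rewrite (_ : Ordinal Hi = 1) //; exact: val_inj.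
- by rewrite (_ : Ordinal Hi = 2%:R) //; exact: val_inj.
- by rewrite (_ : Ordinal Hi = 3%:R) //; exact: val_inj.
Qed.

(* Reversed Cauchy-Schwarz inequality. *)
Lemma past_timelike_null_sign u x :
  lorentz u u < 0 -> u ord0 0 < 0 -> lorentz x x = 0 -> x ord0 0 != 0 ->
  (0 < lorentz u x) = (0 < x ord0 0).
Proof.
move=> uu u0 xx x0n.
(* It is enough to treat future null vectors: a past one is handled through its opposite. *)
suff pos y : lorentz y y = 0 -> 0 < y ord0 0 -> 0 < lorentz u y.
  have [x0|x0] := ltP 0 (x ord0 0); first exact: pos.
  have := pos (- x); rewrite !lorentz_lin !mxE !oppr_gt0 opprK.
  move=> /(_ xx); rewrite lt_neqAle x0n x0 => /(_ isT) h.
  by apply/negbTE; rewrite -leNgt ltW.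
move=> {x xx x0n} yy y0; move: uu u0 yy y0; rewrite !lorentzE.
set x0 := u ord0 0; set x1 := u ord0 1; set x2 := u ord0 2%:R; set x3 := u ord0 3%:R.
set y0 := y ord0 0; set y1 := y ord0 1; set y2 := y ord0 2%:R; set y3 := y ord0 3%:R.
move=> uu u0 yy y0p.
set d := x1 * y1 + x2 * y2 + x3 * y3.
have cs : d ^+ 2 <= (x1 * x1 + x2 * x2 + x3 * x3) * (y0 * y0).
  have -> : y0 * y0 = y1 * y1 + y2 * y2 + y3 * y3 by lra.
  rewrite -subr_ge0 (_ : _ - _ = (x1 * y2 - x2 * y1) ^+ 2 +
    (x1 * y3 - x3 * y1) ^+ 2 + (x2 * y3 - x3 * y2) ^+ 2); last by rewrite /d; ring.
  by rewrite !addr_ge0 // sqr_ge0.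
have lt : d ^+ 2 < (- x0 * y0) ^+ 2.
  apply: (le_lt_trans cs); rewrite exprMn sqrrN !expr2 ltr_pM2r ?mulr_gt0 //; lra.
have p0 : 0 < - x0 * y0 by rewrite mulr_gt0 // oppr_gt0.
have : `|d| < - x0 * y0.
  by rewrite -(ltr_pXn2r (n := 2)) // ?nnegrE ?normr_ge0 ?ltW // real_normK // num_real.
rewrite ltr_norml => /andP[h _]; rewrite /d in h; lra.
Qed.

End LorentzForm.

(** * Directional derivatives *)

Section DirectionalDerivatives.
Variables (R : realType) (V : normedModType R).
Implicit Types (p v w : V).

Lemma is_derive_line (W : normedModType R) (f : V -> W) p v (s : R) d :
  is_derive (s *: v + p) v f d -> is_derive s 1 (fun t : R => f (t *: v + p)) d.
Proof.
have e : (fun h : R =>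
    h^-1 *: (((fun t : R => f (t *: v + p)) \o shift s) (h *: 1) - f (s *: v + p)))
       = (fun h : R => h^-1 *: ((f \o shift (s *: v + p)) (h *: v) - f (s *: v + p))).
  by apply/funext => h /=; rewrite [h%:A]mulr1 scalerDl addrA.
by case=> c d'; split; [rewrite /derivable /= e|rewrite /derive /= e].
Qed.

Lemma is_derive_mulr (f g : V -> R) p v (df dg : R) :
  is_derive p v f df -> is_derive p v g dg ->
  is_derive p v (fun q => f q * g q) (df * g p + f p * dg).
Proof.
move=> hf hg.
have := is_deriveM hf hg; rewrite addrC => h.
by move: h; rewrite /GRing.scale /= (mulrC (g p)).
Qed.

Lemma is_derive_addr (W : normedModType R) (f g : V -> W) p v df dg :
  is_derive p v f df -> is_derive p v g dg ->
  is_derive p v (fun q => f q + g q) (df + dg).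
Proof. by move=> hf hg; exact: is_deriveD. Qed.

Lemma is_derive_coord n (F : V -> 'rV[R]_n) p v d i :
  is_derive p v F d -> is_derive p v (fun q => F q ord0 i) (d ord0 i).
Proof.
case=> hF <-; split; first exact: (iffLR (derivable_mxP F p v)).
by rewrite derive_mx // mxE.
Qed.

Lemma is_derive_row n (F : V -> 'rV[R]_n) p v (d : 'rV[R]_n) :
  (forall i, is_derive p v (fun q => F q ord0 i) (d ord0 i)) -> is_derive p v F d.
Proof.
move=> h; have hF : derivable F p v.
  by apply/derivable_mxP => i j; rewrite (ord1 i); case: (h j).
split=> //; rewrite derive_mx //; apply/matrixP => i j; rewrite mxE (ord1 i).
by case: (h j).
Qed.

Lemma is_derive_near (W : normedModType R) (f g : V -> W) (U : set V) p v d :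
  open U -> U p -> (forall q, U q -> f q = g q) ->
  is_derive p v f d -> is_derive p v g d.
Proof.
move=> oU Up fg; apply: near_eq_is_derive; near=> q; apply: fg; near: q.
exact: open_nbhs_nbhs.
Unshelve. all: by end_near. Qed.

Lemma is_derive_lorentz (F G : V -> 'rV[R]_4) p v dF dG :
  is_derive p v F dF -> is_derive p v G dG ->
  is_derive p v (fun q => lorentz (F q) (G q))
    (lorentz dF (G p) + lorentz (F p) dG).
Proof.
move=> hF hG.
have c i := is_derive_mulr (is_derive_coord i hF) (is_derive_coord i hG).
have -> : (fun q => lorentz (F q) (G q)) = fun q =>
    - (F q ord0 0 * G q ord0 0) + F q ord0 1 * G q ord0 1
    + F q ord0 2%:R * G q ord0 2%:R + F q ord0 3%:R * G q ord0 3%:R.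
  by apply/funext => q; rewrite lorentzE.
apply: is_derive_eq (is_derive_addr (is_derive_addr (is_derive_addr
  (is_deriveN (c 0)) (c 1)) (c 2%:R)) (c 3%:R)) _.
by rewrite !lorentzE; ring.
Qed.

Lemma is_derive_lorentz_cst (F : V -> 'rV[R]_4) p v dF (a : 'rV[R]_4) :
  is_derive p v F dF -> is_derive p v (fun q => lorentz (F q) a) (lorentz dF a).
Proof.
move=> hF; have := is_derive_lorentz hF (is_derive_cst a p v).
by rewrite lorentz0r addr0.
Qed.

Lemma mean_value_line (f df : V -> R) p v (h : R) : 0 < h ->
  (forall s, 0 <= s <= h -> is_derive (s *: v + p) v f (df (s *: v + p))) ->
  exists2 s, 0 <= s <= h & f (h *: v + p) - f p = h * df (s *: v + p).
Proof.
move=> h0 hdf.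
have d s : 0 <= s <= h ->
    is_derive s 1 (fun t : R => f (t *: v + p)) (df (s *: v + p)).
  by move=> sh; apply: is_derive_line; exact: hdf.
have [s||s sh] := MVT (f := fun t : R => f (t *: v + p))
    (df := fun s => df (s *: v + p)) h0.
- by rewrite in_itv /= => /andP[s0 sh]; apply: d; rewrite !ltW.
- apply: derivable_within_continuous => s; rewrite in_itv /= => sh.
  by case: (d s sh).
rewrite scale0r add0r subr0 mulrC => ->; exists s => //.
by move: sh; rewrite in_itv /= => /andP[s0 sh]; rewrite !ltW.
Qed.

(** The mean value theorem is applied twice: along [v] to the increment [g] of [f] in the direction
    [w], then along [w] to [fv]. *)
Lemma second_difference (f fv fvw : V -> R) p v w (h : R) : 0 < h ->
  (forall s t, 0 <= s <= h -> 0 <= t <= h ->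
     is_derive (s *: v + (t *: w + p)) v f (fv (s *: v + (t *: w + p))) /\
     is_derive (t *: w + (s *: v + p)) w fv (fvw (t *: w + (s *: v + p)))) ->
  exists s t, [/\ 0 <= s <= h, 0 <= t <= h &
    f (h *: v + (h *: w + p)) - f (h *: w + p) - (f (h *: v + p) - f p) =
    h * (h * fvw (t *: w + (s *: v + p)))].
Proof.
move=> h0 hf.
have hh : 0 <= h <= h by rewrite lexx ltW.
have h00 : 0 <= (0 : R) <= h by rewrite lexx ltW.
pose g q := f (q + h *: w) - f q.
pose dg q := fv (q + h *: w) - fv q.
have gE s : 0 <= s <= h -> is_derive (s *: v + p) v g (dg (s *: v + p)).
  move=> sh; apply: is_deriveB; last first.
    by have [] := hf s 0 sh h00; rewrite scale0r add0r.
  have [[d1 d2] _] := hf s h sh hh.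
  have e0 : s *: v + p + h *: w = s *: v + (h *: w + p) by rewrite -addrA (addrC p).
  have e : (fun k : R => k^-1 *: (((fun q => f (q + h *: w)) \o shift (s *: v + p)) (k *: v)
      - f (s *: v + p + h *: w)))
       = (fun k : R => k^-1 *: ((f \o shift (s *: v + (h *: w + p))) (k *: v)
      - f (s *: v + (h *: w + p)))).
    by apply/funext => k /=; rewrite -addrA e0.
  by rewrite e0; split; [rewrite /derivable /= e|rewrite /derive /= e].
have [s sh es] := mean_value_line h0 gE.
have [t|t th et] := mean_value_line (f := fv) (df := fvw) (p := s *: v + p) (v := w) h0.
  by move=> th; case: (hf s t sh th).
exists s, t; split=> //.
rewrite -et (addrCA (h *: w)); move: es; rewrite /dg -(addrA (s *: v)) (addrC p (h *: w)) => <-.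
by rewrite /g -(addrA (h *: v)) (addrC p (h *: w)); set a := f _; set b := f _; set c := f _; ring.
Qed.

(** Schwarz's theorem. The second difference of [f] is symmetric in [v] and [w], so
    [second_difference], read in both orders, gives equal values of [fvw] and [fwv] at two points
    arbitrarily close to [p]; continuity concludes. *)
Lemma mixed_derivatives_eq (f fv fw fvw fwv : V -> R) (U : set V) p v w :
  open U -> U p ->
  (forall q, U q -> is_derive q v f (fv q)) ->
  (forall q, U q -> is_derive q w f (fw q)) ->
  (forall q, U q -> is_derive q w fv (fvw q)) ->
  (forall q, U q -> is_derive q v fw (fwv q)) ->
  {for p, continuous fvw} -> {for p, continuous fwv} -> fvw p = fwv p.
Proof.
move=> oU Up dv dw dvw dwv c1 c2.
apply/eqP; rewrite -subr_eq0 -normr_le0; apply/ler_addgt0Pl => e e0; rewrite addr0.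
have e2 : 0 < e / 2 by rewrite divr_gt0.
have b1 : \forall q \near p, `|fvw p - fvw q| < e / 2.
  exact: ((cvgrPdist_lt _ _).1 c1 _ e2).
have b2 : \forall q \near p, `|fwv p - fwv q| < e / 2.
  exact: ((cvgrPdist_lt _ _).1 c2 _ e2).
have : \forall q \near p, U q /\
    (`|fvw p - fvw q| < e / 2 /\ `|fwv p - fwv q| < e / 2).
  apply: filterI; first exact: open_nbhs_nbhs.
  exact: filterI b1 b2.
move=> /nbhs_normP[d /= d0 hd].
(* With [h = d / (2 M)] every point of the parallelogram of sides [h v] and [h w] is within
   [h M = d / 2] of [p]. The summand 1 keeps [M] positive when [v] and [w] vanish. *)
pose M := `|v| + `|w| + 1.
have M0 : 0 < M by rewrite /M ltr_wpDl // addr_ge0.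
pose h := d / (2 * M).
have h0 : 0 < h by rewrite divr_gt0 // mulr_gt0.
have near_h s t : 0 <= s <= h -> 0 <= t <= h ->
    ball_ Num.norm p d (s *: v + (t *: w + p)).
  move=> /andP[s0 sh] /andP[t0 th]; rewrite /ball_ /= distrC addrA addrK.
  rewrite (le_lt_trans (ler_normD _ _)) // !normrZ (ger0_norm s0) (ger0_norm t0).
  rewrite (@le_lt_trans _ _ (h * M)) //; last first.
    by rewrite /h invfM mulrA mulfVK ?gt_eqF // gtr_pMr // invf_lt1 // ltr1n.
  rewrite /M !mulrDr mulr1 -addrA lerD ?ler_wpM2r //.
  by rewrite (le_trans (ler_wpM2r _ th)) // lerDl ltW.
have near_h' s t : 0 <= s <= h -> 0 <= t <= h ->
    ball_ Num.norm p d (t *: w + (s *: v + p)).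
  by move=> sh th; rewrite addrCA; exact: near_h.
have [s t sh th|s [t [sh th e1]]] :=
    second_difference (f := f) (fv := fv) (fvw := fvw) (p := p) (v := v) (w := w) h0.
  have [U1 _] := hd _ (near_h s t sh th).
  have [U2 _] := hd _ (near_h' s t sh th).
  by split; [exact: dv|exact: dvw].
have [s' t' sh' th'|s' [t' [sh' th' e2']]] :=
    second_difference (f := f) (fv := fw) (fvw := fwv) (p := p) (v := w) (w := v) h0.
  have [U1 _] := hd _ (near_h' t' s' th' sh').
  have [U2 _] := hd _ (near_h t' s' th' sh').
  by split; [exact: dw|exact: dwv].
have E : fvw (t *: w + (s *: v + p)) = fwv (t' *: v + (s' *: w + p)).
  have hn0 : h != 0 by rewrite gt_eqF.
  apply: (mulfI hn0); apply: (mulfI hn0); apply: etrans (esym e1) (etrans _ e2').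
  by rewrite (addrCA (h *: v)); set a := f _; set b := f _; set c := f _; ring.
have [_ [{}b1 _]] := hd _ (near_h' s t sh th).
have [_ [_ {}b2]] := hd _ (near_h t' s' th' sh').
rewrite -(subrKA (fvw (t *: w + (s *: v + p)))) {2}E.
by rewrite (le_trans (ler_normD _ _)) // (splitr e) lerD // ltW // distrC.
Qed.

End DirectionalDerivatives.

Section Smooth.
Variables (R : realType) (m n : nat).
Implicit Types (U : set 'rV[R]_m) (X : 'rV[R]_m -> 'rV[R]_n) (p v w : 'rV[R]_m).

Lemma smooth_differentiable U X p : smooth_on U X -> U p -> differentiable X p.
Proof. by move=> /(_ 1%N)[h _]; exact: h. Qed.

Lemma smooth_derive U X v : smooth_on U X -> smooth_on U ('D_v X).
Proof. by move=> h k; have [_ hk] := h k.+1; exact: hk. Qed.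

Lemma smooth_is_derive U X p v :
  smooth_on U X -> U p -> is_derive p v X ('D_v X p).
Proof.
by move=> h Up; apply: DeriveDef => //; apply: diff_derivable; exact: smooth_differentiable Up.
Qed.

Lemma smooth_derive_lin U X p v w (a b : R) : smooth_on U X -> U p ->
  'D_(a *: v + b *: w) X p = a *: 'D_v X p + b *: 'D_w X p.
Proof.
move=> h Up; rewrite !deriveE; do ?exact: smooth_differentiable Up.
by rewrite linearD !linearZ.
Qed.

Lemma smooth_derive_comm U X p v w : open U -> smooth_on U X -> U p ->
  'D_v ('D_w X) p = 'D_w ('D_v X) p.
Proof.
move=> oU sX Up; apply/rowP => i.
have d (Y : 'rV[R]_m -> 'rV[R]_n) z q : smooth_on U Y -> U q ->
    is_derive q z (fun q => Y q ord0 i) ('D_z Y q ord0 i).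
  by move=> sY Uq; exact: is_derive_coord (smooth_is_derive _ sY Uq).
have c z1 z2 : {for p, continuous (fun q => 'D_z1 ('D_z2 X) q ord0 i)}.
  have h := smooth_derive z1 (smooth_derive z2 sX) 0%N p Up.
  exact: (continuous_comp h (@coord_continuous _ _ _ ord0 i _)).
apply: (@mixed_derivatives_eq _ _ (fun q => X q ord0 i)
  (fun q => 'D_w X q ord0 i) (fun q => 'D_v X q ord0 i)
  (fun q => 'D_v ('D_w X) q ord0 i) (fun q => 'D_w ('D_v X) q ord0 i) U p w v) => //.
- by move=> q; exact: d.
- by move=> q; exact: d.
- by move=> q; apply: d; exact: smooth_derive.
- by move=> q; apply: d; exact: smooth_derive.
Qed.

End Smooth.

(** * Spacelike patches *)

Lemma is_derive_cst_on (R : realType) (V W : normedModType R) (U : set V)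
    (f : V -> W) p v a d :
  open U -> U p -> (forall q, U q -> f q = a) -> is_derive p v f d -> d = 0.
Proof.
move=> oU Up fa hf.
have h : is_derive p v (cst a) d by exact: is_derive_near oU Up fa hf.
by rewrite -(@derive_val _ _ _ _ _ _ _ h) derive_cst.
Qed.

Lemma det_mx2 (R : comNzRingType) (A : 'M[R]_2) :
  \det A = A 0 0 * A 1 1 - A 0 1 * A 1 0.
Proof.
rewrite (expand_det_row _ 0) sum_ord2 /cofactor !det_mx11 !mxE /=.
rewrite expr0 expr1 mul1r mulN1r mulrN.
by congr (_ * A _ _ - _ * A _ _); apply: val_inj.
Qed.

Lemma ord2P (i : 'I_2) : i = 0 \/ i = 1.
Proof. by case: i => -[|[|//]] Hi; [left|right]; exact: val_inj. Qed.

(* Sealed copies of the derivative and of the geometric quantities: a failing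
   unification would otherwise unfold them down to limits and matrices. *)
HB.lock Definition dird (R : realType) (V W : normedModType R) (v : V)
  (f : V -> W) (p : V) : W := 'D_v f p.
HB.lock Definition ginv (R : realType) (X : 'rV[R]_2 -> 'rV[R]_4) p k l : R :=
  inv_metric X p k l.
HB.lock Definition chr (R : realType) (X : 'rV[R]_2 -> 'rV[R]_4) k i j p : R :=
  christoffel X k i j p.
HB.lock Definition perp (R : realType) (X : 'rV[R]_2 -> 'rV[R]_4) p z : 'rV[R]_4 :=
  normal_part X p z.

Lemma derive_dird (R : realType) (V W : normedModType R) (v : V) (f : V -> W) :
  'D_v f = dird v f.
Proof. by apply/funext => p; rewrite dird.unlock. Qed.

Lemma smooth_dird (R : realType) m n (U : set 'rV[R]_m) (X : 'rV[R]_m -> 'rV[R]_n) v :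
  smooth_on U X -> smooth_on U (dird v X).
Proof. by rewrite -derive_dird; exact: smooth_derive. Qed.

Lemma smooth_is_dird (R : realType) m n (U : set 'rV[R]_m) (X : 'rV[R]_m -> 'rV[R]_n) p v :
  smooth_on U X -> U p -> is_derive p v X (dird v X p).
Proof. by rewrite -derive_dird; exact: smooth_is_derive. Qed.

Lemma is_dird_val (R : realType) (V W : normedModType R) (v : V) (f : V -> W) p d :
  is_derive p v f d -> dird v f p = d.
Proof. by case=> _; rewrite -derive_dird. Qed.

Lemma derivable_dird (R : realType) (V W : normedModType R) (v : V) (f : V -> W) p :
  derivable f p v -> is_derive p v f (dird v f p).
Proof. by rewrite -derive_dird; exact: derivableP. Qed.

Section SpacelikePatch.
Variables (R : realType) (X : 'rV[R]_2 -> 'rV[R]_4) (U : set 'rV[R]_2).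
Hypotheses (oU : open U) (sX : smooth_on U X) (posX : riemannian_on X U).
Implicit Types (p q v w : 'rV[R]_2) (z e : 'rV[R]_4) (i j k l m : 'I_2).

Local Notation ev := (coord_vec R).
Local Notation T i := (dird (ev i) X).
Local Notation g p i j := (lorentz (T i p) (T j p)).

Lemma partial_dird i : partial X i = T i.
Proof. exact: derive_dird. Qed.

Lemma metric_mxE p i j : metric_mx X p i j = g p i j.
Proof. by rewrite mxE dird.unlock. Qed.

Lemma metric_fun i j : (fun q => metric_mx X q i j) = fun q => g q i j.
Proof. by apply/funext => q; exact: metric_mxE. Qed.

Lemma induced_metricE p v w :
  induced_metric X p v w = lorentz (dird v X p) (dird w X p).
Proof. by rewrite dird.unlock. Qed.

Lemma second_formE p v w : second_form X p v w = perp X p (dird v (dird w X) p).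
Proof. by rewrite perp.unlock -!derive_dird. Qed.

Lemma perpE p z : perp X p z = z -
  (((ginv X p 0 0 * lorentz z (T 0 p)) *: T 0 p + (ginv X p 0 1 * lorentz z (T 0 p)) *: T 1 p) +
   ((ginv X p 1 0 * lorentz z (T 1 p)) *: T 0 p + (ginv X p 1 1 * lorentz z (T 1 p)) *: T 1 p)).
Proof.
have sumE (h : 'I_2 -> 'I_2 -> R) (c : 'I_2 -> R) (F : 'I_2 -> 'rV[R]_4) :
    \sum_k \sum_l (h k l * c k) *: F l =
    ((h 0 0 * c 0) *: F 0 + (h 0 1 * c 0) *: F 1) +
    ((h 1 0 * c 1) *: F 0 + (h 1 1 * c 1) *: F 1) by rewrite !sum_ord2.
rewrite -(sumE (ginv X p) (fun k => lorentz z (T k p)) (fun l => T l p)).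
by rewrite perp.unlock ginv.unlock dird.unlock.
Qed.

Lemma chrE p k i j : chr X k i j p = 2^-1 *
  (ginv X p k 0 * (dird (ev i) (fun q => g q j 0) p
     + dird (ev j) (fun q => g q i 0) p - dird (ev 0) (fun q => g q i j) p) +
   ginv X p k 1 * (dird (ev i) (fun q => g q j 1) p
     + dird (ev j) (fun q => g q i 1) p - dird (ev 1) (fun q => g q i j) p)).
Proof.
rewrite -(sum_ord2 (fun l => ginv X p k l * (dird (ev i) (fun q => g q j l) p
     + dird (ev j) (fun q => g q i l) p - dird (ev l) (fun q => g q i j) p))).
rewrite chr.unlock /christoffel; congr (_ * _); apply: eq_bigr => l _.
by rewrite -(metric_fun j l) -(metric_fun i l) -(metric_fun i j) ginv.unlock dird.unlock.
Qed.

Lemma det_metric p :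
  \det (metric_mx X p) = g p 0 0 * g p 1 1 - g p 0 1 * g p 1 0.
Proof.
by rewrite det_mx2 (metric_mxE p 0 0) (metric_mxE p 0 1) (metric_mxE p 1 0) (metric_mxE p 1 1).
Qed.

Lemma coord_vec_neq0 i : ev i != 0.
Proof.
by apply/eqP => /rowP /(_ i); rewrite !mxE !eqxx => /eqP; rewrite oner_eq0.
Qed.

Lemma metric00_gt0 p : U p -> 0 < g p 0 0.
Proof. by move=> Up; rewrite -induced_metricE; apply: posX => //; exact: coord_vec_neq0. Qed.

Lemma gram_gt0 p : U p -> 0 < g p 0 0 * g p 1 1 - g p 0 1 * g p 1 0.
Proof.
move=> Up; have g0 := metric00_gt0 Up.
have pos a b : b != 0 -> 0 < lorentz (a *: T 0 p + b *: T 1 p) (a *: T 0 p + b *: T 1 p).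
  move=> b0; have v0 : a *: ev 0 + b *: ev 1 != 0.
    apply: contraNneq b0 => /rowP /(_ 1).
    by rewrite !mxE /= mulr1 mulr0 add0r => ->.
  have := posX Up v0; rewrite /induced_metric.
  by rewrite (smooth_derive_lin _ _ _ _ sX Up) -!partial_dird.
(* This is [g00] times the component of [X_1] orthogonal to [X_0]; its square norm is
   [g00 (g00 g11 - g01^2)]. *)
have := pos (- g p 0 1) _ (lt0r_neq0 g0).
rewrite !lorentz_lin (lorentzC (T 1 p) (T 0 p)); move: g0.
move: (g p 0 0) (g p 0 1) (g p 1 1) => a b c a0 h.
rewrite -(pmulr_rgt0 _ a0); apply: etrans h; congr (0 < _); ring.
Qed.

Lemma gram_neq0 p : U p -> g p 0 0 * g p 1 1 - g p 0 1 * g p 1 0 != 0.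
Proof. by move=> Up; rewrite gt_eqF // gram_gt0. Qed.

Lemma ginvM p k m : U p ->
  ginv X p k 0 * g p 0 m + ginv X p k 1 * g p 1 m = (k == m)%:R.
Proof.
move=> Up; have /matrixP/(_ k m) : inv_metric X p *m metric_mx X p = 1%:M.
  by rewrite mulVmx // unitmxE unitfE det_metric gram_neq0.
by rewrite [LHS]mxE sum_ord2 [RHS]mxE (metric_mxE p 0 m) (metric_mxE p 1 m) ginv.unlock.
Qed.

(** The cofactor formula gives both the symmetry of the inverse metric and its differentiability on
    [U]. *)
Lemma ginvE p k l : U p -> ginv X p k l =
  (g p 0 0 * g p 1 1 - g p 0 1 * g p 1 0)^-1 * (if l == 0
    then (k == 0)%:R * g p 1 1 - (k == 1)%:R * g p 1 0
    else (k == 1)%:R * g p 0 0 - (k == 0)%:R * g p 0 1).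
Proof.
move=> Up; apply: (mulfI (gram_neq0 Up)).
rewrite mulrA divff ?gram_neq0 // mul1r.
rewrite -(ginvM k 0 Up) -(ginvM k 1 Up).
move: (g p 0 0) (g p 0 1) (g p 1 0) (g p 1 1) => a b c d.
by case: (ord2P l) => -> /=; ring.
Qed.

Lemma ginvC p k l : U p -> ginv X p k l = ginv X p l k.
Proof.
move=> Up; rewrite !ginvE // (lorentzC (T 1 p) (T 0 p)).
move: (g p 0 0) (g p 0 1) (g p 1 1) => a b c.
by case: (ord2P k) => ->; case: (ord2P l) => -> //=; ring.
Qed.

Lemma perp_pairing p z e :
  (forall i, lorentz e (T i p) = 0) -> lorentz (perp X p z) e = lorentz z e.
Proof.
move=> h; rewrite perpE !lorentz_lin !(lorentzC (T _ p) e) !h.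
by rewrite !mulr0 !addr0 subr0.
Qed.

Lemma perp_orthogonal p z m : U p -> lorentz (perp X p z) (T m p) = 0.
Proof.
move=> Up; rewrite perpE !lorentz_lin.
have h0 := ginvM 0 m Up; have h1 := ginvM 1 m Up.
move: (g p 0 m) (g p 1 m) h0 h1 => a b h0 h1.
set z0 := lorentz z (T 0 p); set z1 := lorentz z (T 1 p).
transitivity (lorentz z (T m p) -
   ((ginv X p 0 0 * a + ginv X p 0 1 * b) * z0 +
    (ginv X p 1 0 * a + ginv X p 1 1 * b) * z1)).
  by ring.
rewrite h0 h1 /z0 /z1; case: (ord2P m) => -> /=.
  by rewrite mul1r mul0r addr0 subrr.
by rewrite mul1r mul0r add0r subrr.
Qed.

Lemma metric_is_derive p v i j : U p ->
  is_derive p v (fun q => g q i j)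
    (lorentz (dird v (T i) p) (T j p) + lorentz (T i p) (dird v (T j) p)).
Proof.
move=> Up; apply: is_derive_lorentz; exact: (smooth_is_dird _ (smooth_dird _ sX) Up).
Qed.

Lemma dird_comm p v w : U p -> dird v (dird w X) p = dird w (dird v X) p.
Proof. by move=> Up; rewrite -!derive_dird; exact: smooth_derive_comm oU sX Up. Qed.

Lemma christoffel_pairing p k i j : U p -> chr X k i j p =
  ginv X p k 0 * lorentz (dird (ev i) (T j) p) (T 0 p) +
  ginv X p k 1 * lorentz (dird (ev i) (T j) p) (T 1 p).
Proof.
move=> Up; rewrite chrE !(is_dird_val (metric_is_derive _ _ _ Up)).
rewrite (dird_comm (ev j) (ev i)) // (dird_comm (ev 0)) // (dird_comm (ev 1)) //.
rewrite (dird_comm (ev 0) (ev j)) // (dird_comm (ev 1) (ev j)) //.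
rewrite !(lorentzC (T _ p)).
set a := lorentz (dird (ev i) (T j) p) (T 0 p).
set b := lorentz (dird (ev i) (T j) p) (T 1 p).
set c := lorentz _ (T j p); set d := lorentz _ (T i p).
set c' := lorentz _ (T j p); set d' := lorentz _ (T i p).
by field.
Qed.

(** Gauss formula: the Christoffel symbols of the induced metric are the tangential coefficients of
    the second derivatives of [X]. *)
Lemma second_form_decomp p i j : U p -> dird (ev i) (T j) p =
  chr X 0 i j p *: T 0 p + chr X 1 i j p *: T 1 p + second_form X p (ev i) (ev j).
Proof.
move=> Up; rewrite second_formE perpE !christoffel_pairing // (ginvC 0 1) //.
move: (dird _ _ p) => z; apply/rowP => n; rewrite !mxE; ring.
Qed.

Lemma ginv_derivable p v k l : U p -> derivable (fun q => ginv X q k l) p v.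
Proof.
move=> Up.
have dg a b : derivable (fun q => g q a b) p v by case: (metric_is_derive v a b Up).
have dd : derivable (fun q => g q 0 0 * g q 1 1 - g q 0 1 * g q 1 0) p v.
  apply: (@derivableB _ _ _ (fun q => g q 0 0 * g q 1 1)).
    exact: (derivableM (dg 0 0) (dg 1 1)).
  exact: (derivableM (dg 0 1) (dg 1 0)).
have dn (b : bool) i j : derivable (fun q => b%:R * g q i j) p v.
  by have [h _] := is_derive_mulr (is_derive_cst (b%:R : R) p v) (metric_is_derive v i j Up).
pose f q := (g q 0 0 * g q 1 1 - g q 0 1 * g q 1 0)^-1 * (if l == 0
    then (k == 0)%:R * g q 1 1 - (k == 1)%:R * g q 1 0
    else (k == 1)%:R * g q 0 0 - (k == 0)%:R * g q 0 1).
have df : derivable f p v.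
  apply: (@derivableM _ _ (fun q => (g q 0 0 * g q 1 1 - g q 0 1 * g q 1 0)^-1)).
    by apply: derivableV => //; exact: gram_neq0.
  case: (l == 0).
    exact: (derivableB (dn _ 1 1) (dn _ 1 0)).
  exact: (derivableB (dn _ 0 0) (dn _ 0 1)).
have : is_derive p v (fun q => ginv X q k l) (dird v f p).
  apply: is_derive_near oU Up _ (derivable_dird df) => q Uq.
  by rewrite ginvE.
by case.
Qed.

Lemma chr_derivable p v k i j : U p -> derivable (chr X k i j) p v.
Proof.
move=> Up.
pose h l q := ginv X q k l * lorentz (dird (ev i) (T j) q) (T l q).
have dh l : derivable (h l) p v.
  apply: (@derivableM _ _ (fun q => ginv X q k l)); first exact: ginv_derivable.
  by case: (is_derive_lorentz (smooth_is_dird v (smooth_dird (ev i) (smooth_dird (ev j) sX)) Up)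
    (smooth_is_dird v (smooth_dird (ev l) sX) Up)).
have : is_derive p v (chr X k i j) (dird v (h 0 + h 1) p).
  apply: is_derive_near oU Up _ (derivable_dird (derivableD (dh 0) (dh 1))) => q Uq.
  by rewrite christoffel_pairing.
by case.
Qed.

(* Gauss equation for a normal field [c - k X] with [c] constant, whose
   derivative is [- k dX]. *)
Lemma gauss_curvature_umbilical (c : 'rV[R]_4) (k : R) p :
  (forall q i, U q -> lorentz (c - k *: X q) (T i q) = 0) ->
  (forall q i j, U q -> second_form X q (ev i) (ev j) = g q i j *: (c - k *: X q)) ->
  U p -> gauss_curvature X p = k.
Proof.
move=> nor umb Up.
set a := T 0 p.
have na : lorentz (c - k *: X p) a = 0 by exact: nor.
(* Differentiate the Gauss formula for [X_jl] along direction [i] and pair it with the vector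
   [a = X_0(p)], kept fixed. The normal term contributes only through its derivative [- k X_i],
   since [c - k X] is orthogonal to [a] at [p]. *)
have E i j l : lorentz (dird (ev i) (dird (ev j) (T l)) p) a =
   (dird (ev i) (chr X 0 j l) p
     + chr X 0 j l p * chr X 0 i 0 p + chr X 1 j l p * chr X 0 i 1 p) * g p 0 0
   + (dird (ev i) (chr X 1 j l) p
     + chr X 0 j l p * chr X 1 i 0 p + chr X 1 j l p * chr X 1 i 1 p) * g p 1 0
   - k * g p j l * g p i 0.
  set D := ev i.
  have sT m : smooth_on U (T m) by exact: smooth_dird.
  pose G m q := chr X m j l q * lorentz (T m q) a.
  have dG m : is_derive p D (G m) (dird D (chr X m j l) p * lorentz (T m p) a
      + chr X m j l p * lorentz (dird D (T m) p) a).
    apply: is_derive_mulr; first by apply: derivable_dird; exact: chr_derivable.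
    exact: is_derive_lorentz_cst (smooth_is_dird D (sT m) Up).
  pose N q := g q j l * lorentz (c - k *: X q) a.
  have dN : is_derive p D N (dird D (fun q => g q j l) p * lorentz (c - k *: X p) a
      + g p j l * lorentz (- (k *: T i p)) a).
    apply: is_derive_mulr.
      by apply: derivable_dird; case: (metric_is_derive D j l Up).
    apply: is_derive_lorentz_cst.
    apply: (is_derive_eq (is_derive_addr (is_derive_cst c p D)
      (is_deriveN (is_deriveZ k (smooth_is_dird D sX Up))))).
    by rewrite add0r.
  have hS m : lorentz (dird D (T m) p) a = chr X 0 i m p * g p 0 0 + chr X 1 i m p * g p 1 0.
    by rewrite second_form_decomp // umb // 2!lorentzDl !lorentzZl na mulr0 addr0.
  have decomp q : U q -> G 0 q + G 1 q + N q = lorentz (dird (ev j) (T l) q) a.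
    by move=> Uq; rewrite second_form_decomp // umb // 2!lorentzDl !lorentzZl.
  have dL := is_derive_near oU Up decomp (is_derive_addr (is_derive_addr (dG 0) (dG 1)) dN).
  have dL' := is_derive_lorentz_cst a (smooth_is_dird D (smooth_dird (ev j) (sT l)) Up).
  rewrite -(is_dird_val dL') (is_dird_val dL) na mulr0 add0r lorentzNl lorentzZl (hS 0) (hS 1).
  move: (dird D (chr X 0 j l) p) (dird D (chr X 1 j l) p) (chr X 0 j l p) (chr X 1 j l p).
  move: (chr X 0 i 0 p) (chr X 1 i 0 p) (chr X 0 i 1 p) (chr X 1 i 1 p).
  rewrite -/a; move: (g p 0 0) (g p 1 0) (g p j l).
  move: (lorentz (T i p) a) (lorentz a a) (lorentz (T 1 p) a) => *.
  ring.
rewrite /gauss_curvature det_metric; apply: (mulIf (gram_neq0 Up)).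
rewrite mulfVK ?gram_neq0 // sum_ord2 (metric_mxE p 0 0) (metric_mxE p 1 0).
have rE m : riemann X m 0 1 1 p = dird (ev 0) (chr X m 1 1) p - dird (ev 1) (chr X m 0 1) p
    + ((chr X 0 1 1 p * chr X m 0 0 p - chr X 0 0 1 p * chr X m 1 0 p)
    + (chr X 1 1 1 p * chr X m 0 1 p - chr X 1 0 1 p * chr X m 1 1 p)).
  rewrite -(sum_ord2 (fun l => chr X l 1 1 p * chr X m 0 l p - chr X l 0 1 p * chr X m 1 l p)).
  by rewrite chr.unlock dird.unlock.
(* The third derivatives on the left of [e0] and [e1] agree, so the difference of the right sides
   vanishes; it equates the lowered Riemann component with [k (g00 g11 - g01 g10)]. *)
have e0 := E 0 1 1; have e1 := E 1 0 1.
have s : dird (ev 0) (dird (ev 1) (T 1)) p = dird (ev 1) (dird (ev 0) (T 1)) p.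
  by rewrite -!derive_dird; apply: smooth_derive_comm oU _ Up;
     rewrite derive_dird; exact: smooth_dird.
rewrite s {}e1 in e0; rewrite (rE 0) (rE 1).
move: e0; rewrite (lorentzC (T 0 p) (T 1 p)).
move: (dird _ (chr X 0 1 1) p) (dird _ (chr X 1 1 1) p).
move: (dird _ (chr X 0 0 1) p) (dird _ (chr X 1 0 1) p).
move: (chr X 0 1 1 p) (chr X 0 0 1 p) (chr X 1 1 1 p) (chr X 1 0 1 p).
move: (chr X 0 0 0 p) (chr X 0 1 0 p) (chr X 1 0 0 p) (chr X 1 1 0 p).
move: (g p 0 0) (g p 1 0) (g p 1 1) => *.
lra.
Qed.

End SpacelikePatch.

(** * Patches of hyperplane sections of the lightcone *)

Section LightconePatch.
Variables (R : realType) (X : 'rV[R]_2 -> 'rV[R]_4) (U : set 'rV[R]_2).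
Hypotheses (oU : open U) (sX : smooth_on U X) (posX : riemannian_on X U).
Hypothesis XX : forall q, U q -> lorentz (X q) (X q) = 0.
Implicit Types (p q v w : 'rV[R]_2).

Lemma null_tangent p v : U p -> lorentz (dird v X p) (X p) = 0.
Proof.
move=> Up; have d := is_derive_lorentz (smooth_is_dird v sX Up) (smooth_is_dird v sX Up).
have := is_derive_cst_on oU Up XX d; rewrite (lorentzC (X p)); lra.
Qed.

Lemma null_second_derivative p v w : U p ->
  lorentz (dird v (dird w X) p) (X p) = - induced_metric X p v w.
Proof.
move=> Up; have d := is_derive_lorentz
  (smooth_is_dird v (smooth_dird w sX) Up) (smooth_is_dird v sX Up).
have := is_derive_cst_on oU Up (fun q Uq => null_tangent w Uq) d.
rewrite induced_metricE (lorentzC (dird w X p)); lra.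
Qed.

(** The tool for vector identities on the patch: a vector vanishes once its pairings with [X], [c]
    and both tangent vectors do. *)
Lemma frame_nondeg p (c n : 'rV[R]_4) : U p ->
  lorentz c (X p) = -1 -> (forall i, lorentz c (dird (coord_vec R i) X p) = 0) ->
  lorentz n (X p) = 0 -> lorentz n c = 0 ->
  (forall i, lorentz n (dird (coord_vec R i) X p) = 0) -> n = 0.
Proof.
move=> Up cX ci nX nc ni.
apply: (frame_orthogonal_eq0 (XX Up) cX
  (w0 := dird (coord_vec R 0) X p) (w1 := dird (coord_vec R 1) X p)) => //.
- exact: null_tangent.
- exact: null_tangent.
- by rewrite lorentzC.
- by rewrite lorentzC.
- exact: (gram_neq0 sX posX).
Qed.

Section AffineSlice.
Variables (c : 'rV[R]_4) (k : R).
Hypotheses (cX : forall q, U q -> lorentz c (X q) = -1) (cc : lorentz c c = - k).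

Lemma slice_tangent p v : U p -> lorentz (dird v X p) c = 0.
Proof.
move=> Up; have d := is_derive_lorentz_cst c (smooth_is_dird v sX Up).
by apply: (is_derive_cst_on oU Up _ d) => q Uq; rewrite lorentzC; exact: cX.
Qed.

Lemma slice_second_derivative p v w : U p -> lorentz (dird v (dird w X) p) c = 0.
Proof.
move=> Up; have d := is_derive_lorentz_cst c (smooth_is_dird v (smooth_dird w sX) Up).
exact: (is_derive_cst_on oU Up (fun q Uq => slice_tangent w Uq) d).
Qed.

Lemma slice_normal p i : U p -> lorentz (c - k *: X p) (dird (coord_vec R i) X p) = 0.
Proof.
move=> Up; rewrite !lorentz_lin !(lorentzC _ (dird (coord_vec R i) X p)).
by rewrite slice_tangent // null_tangent // mulr0 subr0.
Qed.

Lemma slice_second_form p v w : U p ->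
  second_form X p v w = induced_metric X p v w *: (c - k *: X p).
Proof.
move=> Up; rewrite second_formE; apply/eqP; rewrite -subr_eq0; apply/eqP.
have ci i : lorentz c (dird (coord_vec R i) X p) = 0 by rewrite lorentzC slice_tangent.
have xi i : lorentz (X p) (dird (coord_vec R i) X p) = 0 by rewrite lorentzC null_tangent.
apply: (frame_nondeg Up (cX Up)) => //.
- rewrite lorentzDl (perp_pairing _ xi) null_second_derivative //.
  by rewrite !lorentz_lin cX // XX //; ring.
- rewrite lorentzDl (perp_pairing _ ci) slice_second_derivative //.
  by rewrite !lorentz_lin (lorentzC (X p)) cX // cc; ring.
- move=> i; rewrite lorentzDl (perp_orthogonal sX posX) // lorentzNl lorentzZl.
  by rewrite slice_normal // mulr0 subr0.
Qed.

Lemma slice_mean_curvature p : U p -> mean_curvature_vec X p = c - k *: X p.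
Proof.
move=> Up.
have h0 := ginvM sX posX 0 0 Up; have h1 := ginvM sX posX 1 1 Up.
rewrite /mean_curvature_vec (eq_bigr (fun i => \sum_j (ginv X p i j *
    lorentz (dird (coord_vec R i) X p) (dird (coord_vec R j) X p)) *: (c - k *: X p))).
  (* The contraction of the inverse metric with the metric is 2, which cancels [2^-1]. *)
  rewrite sum_ord2 !sum_ord2 -!scalerDl scalerA -[RHS]scale1r; congr (_ *: _).
  move: h0 h1; rewrite (lorentzC (dird (coord_vec R 1) X p) (dird (coord_vec R 0) X p)).
  by move=> -> ->; rewrite -mulr2n mulVf ?pnatr_eq0.
move=> i _; apply: eq_bigr => j _.
by rewrite slice_second_form // scalerA induced_metricE ginv.unlock.
Qed.

Lemma slice_umbilical : umbilical_on X U.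
Proof.
by move=> p Up v w; rewrite slice_second_form // slice_mean_curvature.
Qed.

Lemma slice_gauss_curvature p : U p -> gauss_curvature X p = k.
Proof.
move=> Up; apply: (gauss_curvature_umbilical oU sX posX (c := c)) => //.
- by move=> q i Uq; exact: slice_normal.
- by move=> q i j Uq; rewrite slice_second_form // induced_metricE.
Qed.

(* The hypothesis says that [p] is a critical point of [<a, X>]. *)
Lemma slice_critical (a : 'rV[R]_4) p : U p ->
  (forall i, lorentz a (dird (coord_vec R i) X p) = 0) ->
  a = (k * lorentz a (X p) - lorentz a c) *: X p - lorentz a (X p) *: c.
Proof.
move=> Up ai; apply/eqP; rewrite -subr_eq0; apply/eqP.
have ci i : lorentz c (dird (coord_vec R i) X p) = 0 by rewrite lorentzC slice_tangent.
have xi i : lorentz (X p) (dird (coord_vec R i) X p) = 0 by rewrite lorentzC null_tangent.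
apply: (frame_nondeg Up (cX Up)) => //.
- by rewrite !lorentz_lin XX // cX //; ring.
- by rewrite !lorentz_lin (lorentzC (X p)) cX // cc; ring.
- by move=> i; rewrite !lorentz_lin ai xi ci; ring.
Qed.

Lemma slice_critical_norm (a : 'rV[R]_4) p : U p ->
  (forall i, lorentz a (dird (coord_vec R i) X p) = 0) ->
  lorentz a a = k * lorentz a (X p) ^+ 2 - 2 * lorentz a c * lorentz a (X p).
Proof.
move=> Up ai; rewrite {2}(slice_critical Up ai) !lorentz_lin; ring.
Qed.

End AffineSlice.

End LightconePatch.

(** * Functions on the plane with vanishing partial derivatives *)

Section ConstantOnPlane.
Variables (R : realType).

Lemma constant_along_line (V : normedModType R) (f : V -> R) (v : V) :
  (forall q, is_derive q v f 0) -> forall p (s : R), f (s *: v + p) = f p.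
Proof.
move=> df; have pos p (s : R) : 0 < s -> f (s *: v + p) = f p.
  move=> s0; have [t _] := mean_value_line (df := fun=> 0) (p := p) s0 (fun t _ => df _).
  by rewrite mulr0 => /subr0_eq.
move=> p s; have [s0|s0|<-] := ltrgtP 0 s; last by rewrite scale0r add0r.
  exact: pos.
by rewrite -[in RHS](addKr (s *: v) p) -scaleNr [RHS]pos // oppr_gt0.
Qed.

Lemma constant_of_partials (f : 'rV[R]_2 -> R) :
  (forall q i, is_derive q (coord_vec R i) f 0) -> forall p, f p = f 0.
Proof.
move=> df p.
have -> : p = p ord0 0 *: coord_vec R 0 + (p ord0 1 *: coord_vec R 1 + 0).
  rewrite addr0 {1}(row_sum_delta p) sum_ord2.
  by [].
by rewrite !constant_along_line.
Qed.

End ConstantOnPlane.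

(** * Umbilical patches of the lightcone *)

Lemma is_derive_scaler (R : realType) (V : normedModType R) n (a : V -> R)
    (Z : V -> 'rV[R]_n) p v da dZ :
  is_derive p v a da -> is_derive p v Z dZ ->
  is_derive p v (fun q => a q *: Z q) (da *: Z p + a p *: dZ).
Proof.
move=> ha hZ; apply: is_derive_row => i.
under eq_fun do rewrite mxE.
by rewrite !mxE; exact: is_derive_mulr ha (is_derive_coord i hZ).
Qed.

Section UmbilicalLightconePatch.
Variables (R : realType) (X H : 'rV[R]_2 -> 'rV[R]_4).
Hypotheses (sX : smooth_on setT X) (posX : riemannian_on X setT).
Hypothesis XX : forall q, lorentz (X q) (X q) = 0.
Hypothesis IIH : forall q v w,
  second_form X q v w = lorentz (dird v X q) (dird w X q) *: H q.
Implicit Types (p q v w : 'rV[R]_2) (i j l m : 'I_2).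

Local Notation ev := (coord_vec R).
Local Notation T i := (dird (ev i) X).
Local Notation g p i j := (lorentz (T i p) (T j p)).

Let XX' q : [set: 'rV[R]_2] q -> lorentz (X q) (X q) = 0.
Proof. by []. Qed.

Let dT q v i : is_derive q v (T i) (dird v (T i) q).
Proof. exact: (smooth_is_dird _ (smooth_dird _ sX)). Qed.

(** [H] is known only through [IIH]. Since [g00 > 0], it is a multiple of [II(X_0, X_0)] and
    inherits the properties of a normal part. *)
Lemma mean_normal q i : lorentz (H q) (T i q) = 0.
Proof.
apply: (mulfI (lt0r_neq0 (metric00_gt0 posX (I : setT q)))).
by rewrite -lorentzZl -IIH second_formE (perp_orthogonal sX posX) // mulr0.
Qed.

Lemma mean_pairing q : lorentz (H q) (X q) = -1.
Proof.
apply: (mulfI (lt0r_neq0 (metric00_gt0 posX (I : setT q)))).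
rewrite -lorentzZl -IIH second_formE perp_pairing.
  by rewrite (null_second_derivative openT sX XX') // induced_metricE mulrN1.
by move=> i; rewrite lorentzC (null_tangent openT sX XX').
Qed.

Lemma mean_second q i j z : (forall m, lorentz z (T m q) = 0) ->
  lorentz (dird (ev i) (T j) q) z = g q i j * lorentz (H q) z.
Proof. by move=> /perp_pairing <-; rewrite -second_formE IIH lorentzZl. Qed.

(** No regularity of [H] is assumed: the quotient [N] of [II(X_0, X_0)] by [g00] equals [H], and is
    built from derivatives of [X] and the inverse metric, all differentiable. *)
Lemma mean_is_derive q v : is_derive q v H (dird v H q).
Proof.
pose N q := (g q 0 0)^-1 *: perp X q (dird (ev 0) (T 0) q).
have -> : H = N.
  apply/funext => p; rewrite /N -second_formE IIH scalerA mulVf ?scale1r //.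
  by rewrite gt_eqF // (metric00_gt0 posX).
have dg : derivable (fun q => (g q 0 0)^-1) q v.
  apply: derivableV; first by rewrite gt_eqF // (metric00_gt0 posX).
  by case: (is_derive_lorentz (dT q v 0) (dT q v 0)).
have d2 : is_derive q v (dird (ev 0) (T 0)) (dird v (dird (ev 0) (T 0)) q).
  exact: (smooth_is_dird _ (smooth_dird _ (smooth_dird _ sX))).
have dZ (k l : 'I_2) := is_derive_scaler (is_derive_mulr
  (derivable_dird (ginv_derivable openT sX posX (v := v) (k := k) (l := l) (I : setT q)))
  (is_derive_lorentz d2 (dT q v k))) (dT q v l).
have dN := is_derive_scaler (derivable_dird dg) (is_deriveB d2
  (is_derive_addr (is_derive_addr (dZ 0 0) (dZ 0 1)) (is_derive_addr (dZ 1 0) (dZ 1 1)))).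
have eN : N = fun q => (g q 0 0)^-1 *: (dird (ev 0) (T 0) q -
  (((ginv X q 0 0 * lorentz (dird (ev 0) (T 0) q) (T 0 q)) *: T 0 q +
    (ginv X q 0 1 * lorentz (dird (ev 0) (T 0) q) (T 0 q)) *: T 1 q) +
   ((ginv X q 1 0 * lorentz (dird (ev 0) (T 0) q) (T 1 q)) *: T 0 q +
    (ginv X q 1 1 * lorentz (dird (ev 0) (T 0) q) (T 1 q)) *: T 1 q))).
  by apply/funext => p; rewrite /N perpE.
by apply: derivable_dird; rewrite eN; have [h _] := dN.
Qed.

(** Weingarten formula, from differentiating [<H, X_m> = 0] with [<X_im, H> = g_im <H, H>]. *)
Lemma mean_derive_tangent q i m :
  lorentz (dird (ev i) H q) (T m q) = - (g q i m * lorentz (H q) (H q)).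
Proof.
have d := is_derive_lorentz (mean_is_derive q (ev i)) (dT q (ev i) m).
have := is_derive_cst_on openT (I : setT q) (fun q _ => mean_normal q m) d.
rewrite (lorentzC (H q)) mean_second; last exact: mean_normal.
by move/eqP; rewrite addr_eq0 => /eqP.
Qed.

Lemma mean_derive_shifted q i m :
  lorentz (dird (ev i) H q + lorentz (H q) (H q) *: T i q) (T m q) = 0.
Proof. by rewrite lorentzDl lorentzZl mean_derive_tangent mulrC addNr. Qed.

(** Differentiate [<X_jl, H> = g_jl <H, H>] along direction [i]. The term [<X_jl, dH>] is handled by
    adding [<H, H> X_i] to [dH], which makes it normal, so that [mean_second] applies. The bracket
    obtained is symmetric in [i] and [j]; only the last term is not. *)
Lemma codazzi q i j l :
  lorentz (dird (ev i) (dird (ev j) (T l)) q) (H q) =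
  lorentz (H q) (H q) * (lorentz (dird (ev i) (T j) q) (T l q)
    + lorentz (dird (ev i) (T l) q) (T j q) + lorentz (dird (ev j) (T l) q) (T i q))
  + g q j l * lorentz (dird (ev i) H q) (H q).
Proof.
have d3 : is_derive q (ev i) (dird (ev j) (T l)) (dird (ev i) (dird (ev j) (T l)) q).
  exact: (smooth_is_dird _ (smooth_dird _ (smooth_dird _ sX))).
have dH := mean_is_derive q (ev i).
have e p : lorentz (dird (ev j) (T l) p) (H p) = g p j l * lorentz (H p) (H p).
  by rewrite mean_second //; exact: mean_normal.
have dl := is_derive_lorentz d3 dH.
have dr := is_derive_mulr (is_derive_lorentz (dT q (ev i) j) (dT q (ev i) l))
  (is_derive_lorentz dH dH).
have dr' := is_derive_near openT (I : setT q) (fun p _ => esym (e p)) dr.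
have := etrans (esym (is_dird_val dl)) (is_dird_val dr').
have := mean_second j l (mean_derive_shifted q i).
rewrite !lorentzDr !lorentzZr mean_normal mulr0 addr0.
rewrite (lorentzC (H q) (dird _ H q)) (lorentzC (T j q) (dird (ev i) (T l) q)).
move: (lorentz (dird (ev j) (T l) q) (dird (ev i) H q)) (lorentz (dird (ev i) H q) (H q)).
move: (lorentz (dird (ev i) (dird (ev j) (T l)) q) (H q)) (lorentz (H q) (H q)).
move: (lorentz (dird (ev i) (T j) q) (T l q)) (lorentz (dird (ev i) (T l) q) (T j q)).
move: (lorentz (dird (ev j) (T l) q) (T i q)) (g q j l) => *.
lra.
Qed.

Lemma mean_norm_derive q i : lorentz (dird (ev i) H q) (H q) = 0.
Proof.
have comm l : dird (ev 0) (dird (ev 1) (T l)) q = dird (ev 1) (dird (ev 0) (T l)) q.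
  rewrite -!derive_dird; apply: (smooth_derive_comm _ _ openT) => //.
  by rewrite derive_dird; exact: smooth_dird.
have c1 : dird (ev 1) (T 0) q = dird (ev 0) (T 1) q by apply: (dird_comm openT sX).
(* Exchanging [i] and [j] in [codazzi] leaves only the last terms. For [l = 0, 1] they form a linear
   system in the two derivatives of [<H, H>] with nonzero Gram determinant. *)
have sym l : g q 1 l * lorentz (dird (ev 0) H q) (H q) =
             g q 0 l * lorentz (dird (ev 1) H q) (H q).
  have a := codazzi q 0 1 l; have b := codazzi q 1 0 l.
  move: a b; rewrite comm c1 => -> .
  move: (lorentz (dird (ev 0) (T 1) q) (T l q)) (lorentz (dird (ev 0) (T l) q) (T 1 q)).
  move: (lorentz (dird (ev 1) (T l) q) (T 0 q)) (lorentz (H q) (H q)).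
  move: (g q 1 l * _) (g q 0 l * _) => *; lra.
have s0 := sym 0; have s1 := sym 1.
have n0 := gram_neq0 sX posX (I : setT q).
have g0 := lt0r_neq0 (metric00_gt0 posX (I : setT q)).
have k0 : lorentz (dird (ev 0) H q) (H q) = 0.
  apply: (mulfI n0); rewrite mulr0.
  move: s0 s1; move: (lorentz (dird (ev 0) H q) (H q)) (lorentz (dird (ev 1) H q) (H q)).
  move: (g q 0 0) (g q 0 1) (g q 1 0) (g q 1 1) => a b c d x y s0 s1.
  transitivity (a * (d * x) - b * (c * x)); first by ring.
  by rewrite s0 s1; ring.
case: (ord2P i) => -> //.
by apply: (mulfI g0); rewrite -s0 k0 !mulr0.
Qed.

(** [H q] itself serves as the fourth frame vector, as [mean_pairing] and [mean_normal] allow. The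
    pairing with [X] vanishes by differentiating [<H, X> = -1], the one with [H] by
    [mean_norm_derive]. *)
Lemma mean_derive q i : dird (ev i) H q + lorentz (H q) (H q) *: T i q = 0.
Proof.
apply: (frame_nondeg openT sX posX XX' (p := q) (c := H q)) => //.
- exact: mean_pairing.
- exact: mean_normal.
- have d := is_derive_lorentz (mean_is_derive q (ev i)) (smooth_is_dird (ev i) sX (I : setT q)).
  have := is_derive_cst_on openT (I : setT q) (fun q _ => mean_pairing q) d.
  rewrite mean_normal addr0 lorentzDl => ->.
  by rewrite lorentzZl (null_tangent openT sX XX') // mulr0 addr0.
- by rewrite lorentzDl mean_norm_derive lorentzZl (lorentzC (T i q)) mean_normal mulr0 addr0.
- exact: mean_derive_shifted.
Qed.

Lemma umbilical_slice : exists (c : 'rV[R]_4) (k : R),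
  lorentz c c = - k /\ forall q, lorentz c (X q) = -1.
Proof.
have kc q : lorentz (H q) (H q) = lorentz (H 0) (H 0).
  apply: (constant_of_partials (f := fun q => lorentz (H q) (H q))) => p i.
  have := is_derive_lorentz (mean_is_derive p (ev i)) (mean_is_derive p (ev i)).
  by rewrite (lorentzC (H p)) mean_norm_derive addr0.
set k := lorentz (H 0) (H 0) in kc.
have dc q i : is_derive q (ev i) (fun q => H q + k *: X q) 0.
  have d := is_derive_addr (mean_is_derive q (ev i))
    (is_deriveZ k (smooth_is_dird (ev i) sX (I : setT q))).
  by move: d; rewrite -(kc q) mean_derive kc.
have cc q : H q + k *: X q = H 0 + k *: X 0.
  apply/rowP => n.
  apply: (constant_of_partials (f := fun q => (H q + k *: X q) ord0 n)) => p i.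
  by have := is_derive_coord n (dc p i); rewrite mxE.
exists (H 0 + k *: X 0), k; split.
  rewrite lorentzDl !lorentzDr !lorentzZl !lorentzZr XX (lorentzC (X 0)) mean_pairing -/k.
  by ring.
by move=> q; rewrite -(cc q) lorentzDl lorentzZl XX mean_pairing mulr0 addr0.
Qed.

End UmbilicalLightconePatch.

(** * Stereographic charts *)

Section RationalFunctions.
Variables (R : realType) (m : nat).

(** This class is stable under directional derivatives, so differentiability of its members yields
    smoothness by induction on the order. Inverses are restricted to denominators without zeros, so
    everything is defined on the whole space. *)
Inductive rational_fun : ('rV[R]_m -> R) -> Prop :=
| rational_cst (c : R) : rational_fun (fun=> c)
| rational_coord i : rational_fun (fun p => p ord0 i)
| rational_add f g : rational_fun f -> rational_fun g ->
    rational_fun (fun p => f p + g p)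
| rational_mul f g : rational_fun f -> rational_fun g ->
    rational_fun (fun p => f p * g p)
| rational_inv f : rational_fun f -> (forall p, f p != 0) ->
    rational_fun (fun p => (f p)^-1).

Lemma rational_differentiable f : rational_fun f -> forall p, differentiable f p.
Proof.
elim=> {f} [c|i|f g _ hf _ hg|f g _ hf _ hg|f _ hf f0] p.
- exact: differentiable_cst.
- exact: differentiable_coord.
- exact: differentiableD.
- exact: differentiableM.
- exact: differentiableV.
Qed.

Lemma rational_derive f v : rational_fun f ->
  exists2 df, rational_fun df & forall p, is_derive p v f (df p).
Proof.
elim=> {f} [c|i|f g hf [df rf df'] hg [dg rg dg']
  |f g hf [df rf df'] hg [dg rg dg']|f hf [df rf df'] f0].
- by exists (fun=> 0); [exact: rational_cst|move=> p; exact: is_derive_cst].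
- exists (fun=> v ord0 i); first exact: rational_cst.
  by move=> p; exact: is_derive_coord (is_derive_id p v).
- exists (fun p => df p + dg p); first exact: rational_add.
  by move=> p; exact: is_derive_addr.
- exists (fun p => df p * g p + f p * dg p).
    by apply: rational_add; exact: rational_mul.
  by move=> p; exact: is_derive_mulr.
- exists (fun p => (-1) * ((f p)^-1 * (f p)^-1) * df p).
    have ri := rational_inv hf f0.
    exact: rational_mul (rational_mul (rational_cst _) (rational_mul ri ri)) rf.
  move=> p; have [d e] := df' p; split; first exact: derivableV.
  by rewrite deriveV // e -invfM -expr2 mulN1r.
Qed.

Lemma differentiable_row n (F : 'rV[R]_m -> 'rV[R]_n) p :
  (forall j, differentiable (fun q => F q ord0 j) p) -> differentiable F p.
Proof.
move=> h; have -> : F = \sum_j (fun q => F q ord0 j *: delta_mx ord0 j).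
  apply/funext => q; rewrite [LHS]row_sum_delta fct_sumE.
  by [].
by apply: differentiable_sum => j; exact: differentiableZl.
Qed.

Lemma rational_smooth n (F : 'rV[R]_m -> 'rV[R]_n) :
  (forall j, rational_fun (fun p => F p ord0 j)) -> smooth_on setT F.
Proof.
move=> rF k; elim: k F rF => [|k IH] F rF /=.
  move=> p _; apply: differentiable_continuous; apply: differentiable_row => j.
  exact: rational_differentiable.
split=> [p _|v].
  by apply: differentiable_row => j; exact: rational_differentiable.
apply: IH => j; have [df rdf hdf] := rational_derive v (rF j).
suff -> : (fun p => 'D_v F p ord0 j) = df by [].
apply/funext => p.
have dF : derivable F p v.
  apply: diff_derivable; apply: differentiable_row => i.
  exact: rational_differentiable.
rewrite derive_mx // mxE.
by case: (hdf p).
Qed.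

End RationalFunctions.

(** A differentiable left inverse [pi] gives everything at once: the chain rule makes ['d phi]
    injective, and the image of an open [V] is the trace on [S] of the open set of points of [W]
    sent into [V]. *)
Lemma local_param_of_retraction (R : realType) n (S W : set 'rV[R]_n)
    (phi : 'rV[R]_2 -> 'rV[R]_n) (pi : 'rV[R]_n -> 'rV[R]_2) :
  open W -> smooth_on setT phi ->
  (forall p, S (phi p) /\ W (phi p)) ->
  (forall p, pi (phi p) = p) ->
  (forall x, S x -> W x -> phi (pi x) = x) ->
  (forall x, W x -> differentiable pi x) ->
  local_param S setT phi.
Proof.
move=> oW sphi SW piK phiK dpi; split=> //.
- exact: openT.
- move=> p _ v w vw.
  have dphi : differentiable phi p by exact: (smooth_differentiable sphi (I : setT p)).
  have e : 'd (pi \o phi) p = 'd pi (phi p) \o 'd phi p :> (_ -> _).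
    by apply: diff_comp => //; apply: dpi; have [] := SW p.
  have eid : pi \o phi = id by apply/funext => q /=; rewrite piK.
  have d z : 'd pi (phi p) ('d phi p z) = z.
    by rewrite -[LHS]/(('d pi (phi p) \o 'd phi p) z) -e eid diff_val.
  by rewrite -(d v) vw d.
- by move=> p q _ _ pq; rewrite -(piK p) pq piK.
- move=> V oV _; exists (W `&` pi @^-1` V).
    rewrite openE => x [Wx Vx]; apply: filterI; first exact: open_nbhs_nbhs.
    apply: (differentiable_continuous (dpi x Wx)).
    exact: open_nbhs_nbhs.
  apply/seteqP; split=> [x [p Vp <-]|x [Sx [Wx Vx]]] /=.
    by have [? ?] := SW p; do !split => //; rewrite piK.
  by exists (pi x) => //; exact: phiK.
Qed.

Lemma local_param_mem (R : realType) n (S : set 'rV[R]_n) U (phi : 'rV[R]_2 -> 'rV[R]_n) p :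
  local_param S U phi -> U p -> S (phi p).
Proof.
(* [local_param] places the image inside [S] through its last clause, taken with [V = U]. *)
move=> [oU _ _ _ h] Up; have [W _ e] := h _ oU (@subset_refl _ _).
have : (phi @` U) (phi p) by exists p.
by rewrite e => -[].
Qed.

Section Stereographic.
Variable R : realType.
Implicit Types (p : 'rV[R]_2) (b : bool).

Let e b : R := (-1) ^+ b.

Let ee b : e b * e b = 1.
Proof. by rewrite /e; case: b; rewrite ?expr0 ?expr1 ?mulrNN mulr1. Qed.

Definition qform p : R := p ord0 0 * p ord0 0 + p ord0 1 * p ord0 1.

Lemma qform_ge0 p : 0 <= qform p.
Proof. by rewrite /qform -!expr2 addr_ge0 // sqr_ge0. Qed.

(* Inverse stereographic projection from the pole [(0, 0, (-1) ^+ b)]. *)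
Definition stereo b p : 'rV[R]_3 := \row_j
  ((if j == 0 then 2 * p ord0 0 else if j == 1 then 2 * p ord0 1
    else e b * (qform p - 1)) * (qform p + 1)^-1).

(** This is [(1, stereo b p)] multiplied by the denominator [qform p + 1]: a polynomial
    parametrization of future null directions. *)
Definition null_stereo b p : 'rV[R]_4 := \row_j
  (if j == 0 then qform p + 1 else if j == 1 then 2 * p ord0 0
   else if j == 2%:R then 2 * p ord0 1 else e b * (qform p - 1)).

Lemma rational_qform : rational_fun qform.
Proof.
by apply: rational_add; apply: rational_mul; exact: rational_coord.
Qed.

Lemma qform1_gt0 p : 0 < qform p + 1.
Proof. by rewrite ltr_wpDl // qform_ge0. Qed.

Lemma qform1_neq0 p : qform p + 1 != 0.
Proof. by rewrite gt_eqF // qform1_gt0. Qed.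

Lemma rational_null_stereo b j : rational_fun (fun p => null_stereo b p ord0 j).
Proof.
under eq_fun do rewrite mxE.
case: (j == 0); first by apply: rational_add; [exact: rational_qform|exact: rational_cst].
case: (j == 1); first by apply: rational_mul; [exact: rational_cst|exact: rational_coord].
case: (j == 2%:R); first by apply: rational_mul; [exact: rational_cst|exact: rational_coord].
apply: rational_mul; first exact: rational_cst.
by apply: rational_add; [exact: rational_qform|exact: rational_cst].
Qed.

Lemma smooth_stereo b : smooth_on setT (stereo b).
Proof.
apply: rational_smooth => j; under eq_fun do rewrite mxE.
apply: rational_mul; last first.
  apply: rational_inv; last exact: qform1_neq0.
  by apply: rational_add; [exact: rational_qform|exact: rational_cst].
case: (j == 0); first by apply: rational_mul; [exact: rational_cst|exact: rational_coord].
case: (j == 1); first by apply: rational_mul; [exact: rational_cst|exact: rational_coord].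
apply: rational_mul; first exact: rational_cst.
by apply: rational_add; [exact: rational_qform|exact: rational_cst].
Qed.

Lemma sphereE (x : 'rV[R]_3) : (unit_sphere2 x) =
  (x ord0 0 ^+ 2 + x ord0 1 ^+ 2 + x ord0 2%:R ^+ 2 = 1).
Proof.
rewrite /unit_sphere2 /= !big_ord_recl big_ord0 addr0 !addrA.
by congr (x _ _ ^+ 2 + x _ _ ^+ 2 + x _ _ ^+ 2 = 1); apply: val_inj.
Qed.

Lemma stereo_sphere b p : unit_sphere2 (stereo b p).
Proof.
rewrite sphereE !mxE /=; have := qform1_neq0 p; have := ee b.
have := erefl (qform p); rewrite {2}/qform.
move: (p ord0 0) (p ord0 1) (qform p) (e b) => x y q s hq ss q0.
transitivity ((4 * (x * x + y * y) + (s * s) * (q - 1) ^+ 2) / (q + 1) ^+ 2).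
  by field.
by rewrite -hq ss; field.
Qed.

Definition unstereo b (x : 'rV[R]_3) : 'rV[R]_2 := \row_j
  ((if j == 0 then x ord0 0 else x ord0 1) * (1 - e b * x ord0 2%:R)^-1).

Lemma stereoK b p : unstereo b (stereo b p) = p.
Proof.
have := qform1_neq0 p; have := ee b => ss q0.
have den : 1 - e b * stereo b p ord0 2%:R = 2 / (qform p + 1).
  rewrite mxE /=; move: (e b) (qform p) ss q0 => s q ss q0.
  transitivity (((q + 1) - (s * s) * (q - 1)) / (q + 1)); first by field.
  by rewrite ss; field.
apply/rowP => j; rewrite [LHS]mxE den.
by case: (ord2P j) => -> /=; rewrite !mxE /=; field.
Qed.

Lemma ord3P (j : 'I_3) : [\/ j = 0, j = 1 | j = 2%:R].
Proof.
case: j => -[|[|[|//]]] Hj; [constructor 1|constructor 2|constructor 3]; exact: val_inj.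
Qed.

Lemma ord4P (j : 'I_4) : [\/ j = 0, j = 1, j = 2%:R | j = 3%:R].
Proof.
case: j => -[|[|[|[|//]]]] Hj;
  [constructor 1|constructor 2|constructor 3|constructor 4]; exact: val_inj.
Qed.

Lemma unstereoK b (x : 'rV[R]_3) : unit_sphere2 x -> 0 < 1 - e b * x ord0 2%:R ->
  stereo b (unstereo b x) = x.
Proof.
rewrite sphereE => Sx Wx; have ss := ee b.
have t0 : 1 - e b * x ord0 2%:R != 0 by rewrite gt_eqF.
have q1 : qform (unstereo b x) + 1 = 2 / (1 - e b * x ord0 2%:R).
  rewrite /qform !mxE /=.
  move: (x ord0 0) (x ord0 1) (x ord0 2%:R) (e b) Sx ss t0 => x0 x1 x2 s Sx ss t0.
  have e1 : x0 * x0 + x1 * x1 = 1 - s * s * x2 ^+ 2 by rewrite ss mul1r -Sx; ring.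
  transitivity ((x0 * x0 + x1 * x1 + (1 - s * x2) ^+ 2) / (1 - s * x2) ^+ 2); first by field.
  by rewrite e1; field.
have q2 : e b * (qform (unstereo b x) - 1) = 2 * x ord0 2%:R / (1 - e b * x ord0 2%:R).
  rewrite -[qform _](addrK 1) q1.
  move: (x ord0 2%:R) (e b) ss t0 => x2 s ss t0.
  transitivity (2 * (s * s) * x2 / (1 - s * x2)); first by field.
  by rewrite ss mulr1.
apply/rowP => j; rewrite [LHS]mxE q1 q2 !mxE /=.
by case: (ord3P j) => -> /=; field.
Qed.

Lemma differentiable_ratio n (f g : 'rV[R]_n -> R) x :
  differentiable f x -> differentiable g x -> g x != 0 ->
  differentiable (fun y => f y * (g y)^-1) x.
Proof. by move=> df dg g0; apply: differentiableM => //; exact: differentiableV. Qed.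

Lemma open_gt0 n (g : 'rV[R]_n -> R) : (forall x, differentiable g x) ->
  open [set x | 0 < g x].
Proof.
move=> dg; rewrite openE => x /= gx.
have /differentiable_continuous c := dg x.
apply: (c [set y | 0 < y]); apply: open_nbhs_nbhs; split=> //.
Qed.

Lemma stereo_local_param b : local_param (@unit_sphere2 R) setT (stereo b).
Proof.
have dc : forall x : 'rV[R]_3, differentiable (fun x : 'rV[R]_3 => 1 - e b * x ord0 2%:R) x.
  move=> x; apply: rational_differentiable.
  apply: rational_add; first exact: rational_cst.
  under eq_fun do rewrite -mulNr.
  by apply: rational_mul; [exact: rational_cst|exact: rational_coord].
apply: (@local_param_of_retraction _ _ _ [set x | 0 < 1 - e b * x ord0 2%:R] _ (unstereo b)).
- exact: open_gt0.
- exact: smooth_stereo.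
- move=> p; split; first exact: stereo_sphere.
  rewrite /= mxE /=; have ss := ee b; have q0 := qform1_gt0 p.
  have q0' := qform1_neq0 p.
  move: (e b) (qform p) ss q0 q0' => s q ss q0 q0'.
  rewrite (_ : _ - _ = ((q + 1) - (s * s) * (q - 1)) / (q + 1)); last by field.
  by rewrite ss divr_gt0 //; lra.
- exact: stereoK.
- by move=> x Sx Wx; exact: unstereoK.
- move=> x Wx; apply: differentiable_row => j; under eq_fun do rewrite mxE.
  apply: differentiable_ratio => //; last by rewrite gt_eqF.
  by case: (j == 0); exact: differentiable_coord.
Qed.

Lemma null_stereo_null b p : lorentz (null_stereo b p) (null_stereo b p) = 0.
Proof.
rewrite lorentzE !mxE /=; have := ee b.
have := erefl (qform p); rewrite {2}/qform.
move: (p ord0 0) (p ord0 1) (qform p) (e b) => x y q s hq ss.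
transitivity (- (q + 1) ^+ 2 + 4 * (x * x + y * y) + s * s * (q - 1) ^+ 2); first by ring.
by rewrite -hq ss; ring.
Qed.

Lemma null_stereo_gt0 b p : 0 < null_stereo b p ord0 0.
Proof. by rewrite mxE /= qform1_gt0. Qed.

(** * Stereographic charts of the spheres of the lightcone *)

Section LightconeSphere.
Variables (u : 'rV[R]_4) (r : R).
Hypotheses (uu : lorentz u u = -1) (u0 : u ord0 0 < 0) (r0 : 0 < r).

(** Each future null ray meets the hyperplane [<u, x> = r] exactly once; this is the meeting
    point. *)
Definition cone_stereo b p : 'rV[R]_4 :=
  (r * (lorentz u (null_stereo b p))^-1) *: null_stereo b p.

(** Stereographic projection of the direction of [x]. Being homogeneous of degree 0, it undoes
    [cone_stereo] whatever the scaling factor. *)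
Definition cone_unstereo b (x : 'rV[R]_4) : 'rV[R]_2 := \row_j
  ((if j == 0 then x ord0 1 else x ord0 2%:R) * (x ord0 0 - e b * x ord0 3%:R)^-1).

Lemma null_stereo_pairing_gt0 b p : 0 < lorentz u (null_stereo b p).
Proof.
rewrite past_timelike_null_sign ?null_stereo_gt0 ?null_stereo_null //.
  by rewrite uu; lra.
by rewrite gt_eqF // null_stereo_gt0.
Qed.

Lemma smooth_cone_stereo b : smooth_on setT (cone_stereo b).
Proof.
apply: rational_smooth => j; under eq_fun do rewrite mxE.
apply: rational_mul; last exact: rational_null_stereo.
apply: rational_mul; first exact: rational_cst.
apply: rational_inv; last by move=> p; rewrite gt_eqF // null_stereo_pairing_gt0.
under eq_fun do rewrite lorentzE -mulNr.
have h (c : R) i : rational_fun (fun p => c * null_stereo b p ord0 i).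
  by apply: rational_mul; [exact: rational_cst|exact: rational_null_stereo].
by do 3!apply: rational_add => //.
Qed.

Lemma null_stereo_ray b (x : 'rV[R]_4) : lorentz x x = 0 ->
  x ord0 0 - e b * x ord0 3%:R != 0 ->
  null_stereo b (cone_unstereo b x) = (2 / (x ord0 0 - e b * x ord0 3%:R)) *: x.
Proof.
rewrite lorentzE => xx t0; have ss := ee b.
have q1 : qform (cone_unstereo b x) + 1 = 2 * x ord0 0 / (x ord0 0 - e b * x ord0 3%:R).
  rewrite /qform !mxE /=.
  move: (x ord0 0) (x ord0 1) (x ord0 2%:R) (x ord0 3%:R) (e b) xx ss t0 => x0 x1 x2 x3 s xx ss t0.
  have e1 : x1 * x1 + x2 * x2 = x0 * x0 - s * s * (x3 * x3) by rewrite ss; lra.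
  transitivity ((x1 * x1 + x2 * x2 + (x0 - s * x3) ^+ 2) / (x0 - s * x3) ^+ 2); first by field.
  by rewrite e1; field.
have q2 : e b * (qform (cone_unstereo b x) - 1) = 2 * x ord0 3%:R / (x ord0 0 - e b * x ord0 3%:R).
  rewrite -[qform _](addrK 1) q1.
  move: (x ord0 0) (x ord0 3%:R) (e b) ss t0 => x0 x3 s ss t0.
  transitivity (2 * (s * s) * x3 / (x0 - s * x3)); first by field.
  by rewrite ss mulr1.
apply/rowP => j; rewrite [LHS]mxE q1 q2 !mxE /=.
by case: (ord4P j) => -> /=; field.
Qed.

Lemma cone_stereoK b p : cone_unstereo b (cone_stereo b p) = p.
Proof.
have a0 : r * (lorentz u (null_stereo b p))^-1 != 0.
  by rewrite mulf_neq0 ?invr_neq0 ?gt_eqF // null_stereo_pairing_gt0.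
have ss := ee b; apply/rowP => j; rewrite /cone_stereo !mxE /=.
move: (r * _) a0 => a a0.
have -> : a * (qform p + 1) - e b * (a * (e b * (qform p - 1))) = 2 * a.
  transitivity (a * (qform p + 1) - (e b * e b) * a * (qform p - 1)); first by ring.
  by rewrite ss; ring.
by case: (ord2P j) => -> /=; field.
Qed.

Lemma cone_unstereoK b x : lightcone_sphere u r x ->
  0 < x ord0 0 - e b * x ord0 3%:R -> cone_stereo b (cone_unstereo b x) = x.
Proof.
move=> [xx ux] t0; have tn0 : x ord0 0 - e b * x ord0 3%:R != 0 by rewrite gt_eqF.
rewrite /cone_stereo null_stereo_ray // lorentzZr ux scalerA.
rewrite (_ : _ * _ = 1) ?scale1r //; field.
by rewrite tn0 gt_eqF.
Qed.

Lemma cone_stereo_local_param b : local_param (lightcone_sphere u r) setT (cone_stereo b).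
Proof.
have dc : forall x : 'rV[R]_4, differentiable (fun x : 'rV[R]_4 => x ord0 0 - e b * x ord0 3%:R) x.
  move=> x; apply: rational_differentiable.
  apply: rational_add; first exact: rational_coord.
  under eq_fun do rewrite -mulNr.
  by apply: rational_mul; [exact: rational_cst|exact: rational_coord].
apply: (@local_param_of_retraction _ _ _ [set x | 0 < x ord0 0 - e b * x ord0 3%:R]
  _ (cone_unstereo b)).
- exact: open_gt0.
- exact: smooth_cone_stereo.
- move=> p; have l0 := null_stereo_pairing_gt0 b p; split.
    split; rewrite /cone_stereo !lorentz_lin.
      by rewrite null_stereo_null !mulr0.
    by rewrite mulfVK // gt_eqF.
  rewrite /= !mxE /=; have a0 : 0 < r * (lorentz u (null_stereo b p))^-1.
    by rewrite divr_gt0.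
  have ss := ee b; move: (r * _) (e b) (qform p) a0 ss => a s q a0 ss.
  rewrite (_ : _ - _ = a * ((q + 1) - (s * s) * (q - 1))); last by ring.
  by rewrite ss mulr_gt0 //; lra.
- exact: cone_stereoK.
- by move=> x Sx Wx; exact: cone_unstereoK.
- move=> x Wx; apply: differentiable_row => j; under eq_fun do rewrite mxE.
  apply: differentiable_ratio => //; last by rewrite gt_eqF.
  by case: (j == 0); exact: differentiable_coord.
Qed.

End LightconeSphere.

End Stereographic.

(** * The spheres of the lightcone *)

Section LightconeSphereGeometry.
Variables (R : realType) (u : 'rV[R]_4) (r : R).
Hypotheses (uu : lorentz u u = -1) (u0 : u ord0 0 < 0) (r0 : 0 < r).

Lemma null_coord0_neq0 (x y : 'rV[R]_4) :
  lorentz x x = 0 -> lorentz y x != 0 -> x ord0 0 != 0.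
Proof.
move=> xx; apply: contraNneq => x0.
suff -> : x = 0 by rewrite lorentz0r.
move: xx; rewrite lorentzE x0 mul0r oppr0 add0r -!expr2 => /eqP.
rewrite !paddr_eq0 ?addr_ge0 ?sqr_ge0 // !sqrf_eq0.
case/andP => /andP[/eqP x1 /eqP x2] /eqP x3.
by apply/rowP => j; rewrite mxE; case: (ord4P j) => ->.
Qed.

Lemma lightcone_sphere_future : lightcone_sphere u r `<=` @future_lightcone R.
Proof.
move=> x [xx ux]; split=> //.
have xn0 : x ord0 0 != 0 by apply: (null_coord0_neq0 (y := u)) => //; rewrite ux gt_eqF.
by rewrite -(past_timelike_null_sign _ u0 xx xn0) ?ux // uu; lra.
Qed.

Lemma lightcone_sphere_regular : regular_surface (lightcone_sphere u r).
Proof.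
move=> x Sx; have [xx x0] := lightcone_sphere_future Sx.
(* As [x_0 > 0], the pole is chosen on the side opposite to the sign of [x_3]. *)
have [b hb] : exists b : bool, 0 < x ord0 0 - (-1) ^+ b * x ord0 3%:R.
  have [x3|x3] := leP (x ord0 3%:R) 0.
    by exists false; rewrite expr0 mul1r; move: x0 => /=; lra.
  by exists true; rewrite expr1 mulN1r opprK; move: x0 => /=; lra.
exists setT, (cone_stereo u r b); split; first exact: cone_stereo_local_param.
by exists (cone_unstereo b x) => //; apply: cone_unstereoK.
Qed.

Section Patch.
Variables (U : set 'rV[R]_2) (phi : 'rV[R]_2 -> 'rV[R]_4).
Hypothesis Hphi : local_param (lightcone_sphere u r) U phi.

Let phiS p : U p -> lightcone_sphere u r (phi p).
Proof. exact: local_param_mem. Qed.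

Let oU : open U. Proof. by case: Hphi. Qed.
Let sphi : smooth_on U phi. Proof. by case: Hphi. Qed.
Let phi_null q : U q -> lorentz (phi q) (phi q) = 0.
Proof. by move=> /phiS[]. Qed.
Let rn0 : r != 0. Proof. by rewrite gt_eqF. Qed.
Let slice q : U q -> lorentz (- r^-1 *: u) (phi q) = -1.
Proof. by move=> /phiS[_ h]; rewrite lorentzZl h mulNr mulVf. Qed.
Let slice_norm : lorentz (- r^-1 *: u) (- r^-1 *: u) = - (1 / r ^+ 2).
Proof. by rewrite lorentzZl lorentzZr uu; field. Qed.

(** A tangent vector is orthogonal to the null vector [phi p], so its square is nonnegative. If the
    square is zero, the tangent vector is a multiple of [phi p], and the hyperplane equation makes
    the multiple zero, against the injectivity of the differential. *)
Lemma lightcone_sphere_riemannian : riemannian_on phi U.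
Proof.
move=> p Up v v0; rewrite induced_metricE.
have t := null_tangent oU sphi phi_null v Up.
have x0 : phi p ord0 0 != 0.
  by have [_ h] := lightcone_sphere_future (phiS Up); rewrite gt_eqF.
have xy : lorentz (phi p) (dird v phi p) = 0 by rewrite lorentzC.
rewrite lt_neqAle (null_orthogonal_ge0 (phi_null Up) x0 xy) andbT eq_sym.
apply/eqP => yy.
have := null_orthogonal_collinear (phi_null Up) x0 xy yy.
set a := _ / _ => y_col.
have := slice_tangent oU sphi slice v Up.
rewrite {1}y_col lorentzZl lorentzC slice // mulrN1 => /eqP; rewrite oppr_eq0 => /eqP a0.
move: y_col; rewrite a0 scale0r -derive_dird deriveE; last exact: smooth_differentiable sphi Up.
move=> dv; case: Hphi => _ _ /(_ p Up) inj _ _; move/eqP: v0; apply.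
by apply: inj; rewrite dv linear0.
Qed.

Lemma lightcone_sphere_umbilical : umbilical_on phi U.
Proof.
exact: (slice_umbilical oU sphi lightcone_sphere_riemannian phi_null slice slice_norm).
Qed.

Lemma lightcone_sphere_gauss p : U p -> gauss_curvature phi p = 1 / r ^+ 2.
Proof.
exact: (slice_gauss_curvature oU sphi lightcone_sphere_riemannian phi_null slice slice_norm).
Qed.

End Patch.

End LightconeSphereGeometry.

(** * Maxima of functions on the sphere *)

Lemma critical_at_max (R : realType) (X : 'rV[R]_2 -> 'rV[R]_4) (a : 'rV[R]_4) p v :
  smooth_on setT X -> (forall q, lorentz a (X q) <= lorentz a (X p)) ->
  lorentz a (dird v X p) = 0.
Proof.
move=> sX hmax; pose f (t : R) := lorentz (X (t *: v + p)) a.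
have df (t : R) : is_derive t (1 : R) f (lorentz (dird v X (t *: v + p)) a).
  apply: (is_derive_line (f := fun q => lorentz (X q) a)).
  exact: is_derive_lorentz_cst (smooth_is_dird v sX (I : setT _)).
have h : is_derive (0 : R) (1 : R) f 0.
  apply: (@derive1_at_max _ f (-1) 1).
  - lra.
  - by move=> t _; case: (df t).
  - by rewrite in_itv /=; apply/andP; split; lra.
  - by move=> t _; rewrite /f scale0r add0r !(lorentzC _ a).
have [_ e1] := df 0; have [_ e2] := h.
by rewrite lorentzC -[p]add0r -[0](scale0r v) -e1 e2.
Qed.

Section SphereExtremum.
Variable R : realType.

(** Projecting from the pole on the far side of [x] keeps the denominator at least 1, so each
    coordinate of the projection is bounded by a coordinate of [x]. The norm on row vectors is the
    maximum norm, which makes the domain a square. *)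
Lemma stereo_cover (x : 'rV[R]_3) : unit_sphere2 x ->
  exists b p, `|p| <= 1 /\ stereo b p = x.
Proof.
move=> Sx; have [b hb] : exists b : bool, (-1) ^+ b * x ord0 2%:R <= 0.
  have [h|h] := leP (x ord0 2%:R) 0; first by exists false; rewrite mul1r.
  by exists true; rewrite mulN1r oppr_le0 ltW.
have t1 : 1 <= 1 - (-1) ^+ b * x ord0 2%:R by rewrite lerBrDr -lerBrDl subrr.
exists b, (unstereo b x); split; last by apply: unstereoK => //; apply: lt_le_trans t1.
have bnd i : `|x ord0 i| <= 1.
  rewrite -(ler_pXn2r (n := 2)) ?nnegrE // real_normK ?num_real // expr1n.
  have := sqr_ge0 (x ord0 0); have := sqr_ge0 (x ord0 1); have := sqr_ge0 (x ord0 2%:R).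
  by move: Sx; rewrite sphereE; case: (ord3P i) => ->; lra.
rewrite [leLHS]/Num.Def.normr/= mx_normrE bigmax_le // => -[i j] _ /=.
rewrite mxE normrM normfV (gtr0_norm (lt_le_trans ltr01 t1)).
rewrite ler_pdivrMr ?(lt_le_trans ltr01 t1) // mul1r (le_trans _ t1) //.
by case: (j == 0); exact: bnd.
Qed.

Lemma unit_box_compact : compact [set p : 'rV[R]_2 | `|p| <= 1].
Proof.
apply: bounded_closed_compact.
  by exists 1; split=> // M M1 p /= /le_trans; apply; exact: ltW.
apply: (@closed_comp _ _ (fun p : 'rV[R]_2 => `|p|) [set t | t <= 1]).
  by move=> p _; exact: norm_continuous.
exact: closed_le.
Qed.

(** Compactness of the sphere is used as compactness of the two squares of [stereo_cover].
    Continuity is asked in the charts because [psi] is constrained on the sphere only, not on the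
    ambient space. *)
Lemma sphere_max (f : 'rV[R]_3 -> R) :
  (forall b, continuous (f \o stereo b)) ->
  exists b p, forall x, unit_sphere2 x -> f x <= f (stereo b p).
Proof.
move=> cf.
have maxb b : exists p, forall q, `|q| <= 1 -> f (stereo b q) <= f (stereo b p).
  have [||p _ hp] := EVT_max_rV (f := f \o stereo b) _ unit_box_compact.
  - by exists 0; rewrite /= normr0.
  - exact: continuous_subspaceT.
  - by exists p => q q1; apply: hp; rewrite inE.
have [p0 h0] := maxb false; have [p1 h1] := maxb true.
have [le01|/ltW le10] := leP (f (stereo false p0)) (f (stereo true p1)).
  exists true, p1 => x /stereo_cover[[] [q [q1 <-]]]; first exact: h1.
  exact: le_trans (h0 _ q1) le01.
exists false, p0 => x /stereo_cover[[] [q [q1 <-]]]; last exact: h0.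
exact: le_trans (h1 _ q1) le10.
Qed.

(* Only one point of the sphere is missed by the first chart. *)
Lemma sphere_eq_of_chart (f : 'rV[R]_3 -> R) (a : R) :
  continuous (f \o stereo true) -> (forall p, f (stereo false p) = a) ->
  forall x, unit_sphere2 x -> f x = a.
Proof.
move=> cf fa.
have off q : q != 0 -> f (stereo true q) = a.
  move=> q0; rewrite -(unstereoK (b := false) (stereo_sphere true q)) //.
  rewrite expr0 mul1r mxE /= expr1 mulN1r.
  have h := qform1_gt0 q; have h' := qform1_neq0 q.
  have hq : 0 < qform q.
    rewrite lt_neqAle qform_ge0 andbT eq_sym; apply: contra q0.
    rewrite /qform -!expr2 paddr_eq0 ?sqr_ge0 // !sqrf_eq0 => /andP[/eqP e0 /eqP e1].
    by apply/eqP/rowP => j; rewrite mxE; case: (ord2P j) => ->.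
  move: (qform q) h h' hq => s h h' hs.
  rewrite (_ : _ - _ = (2 * s) / (s + 1)); last by field.
  by rewrite divr_gt0 // mulr_gt0.
(* [stereo true 0] is the pole of [stereo false]; its value is approached through the nonzero points
   [d / 2 *: coord_vec R 0], where [f] is already known to be [a]. *)
have at0 : f (stereo true 0) = a.
  apply/eqP; rewrite -subr_eq0 -normr_le0; apply/ler_addgt0Pl => e e0; rewrite addr0.
  have : \forall q \near (0 : 'rV[R]_2), `|f (stereo true 0) - f (stereo true q)| < e.
    exact: ((cvgrPdist_lt _ _).1 (cf 0) _ e0).
  move=> /nbhs_normP[d /= d0 hd].
  have := hd (d / 2 *: coord_vec R 0).
  have dn0 : d / 2 *: coord_vec R 0 != 0.
    by rewrite scaler_eq0 negb_or coord_vec_neq0 andbT gt_eqF // divr_gt0.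
  rewrite (off _ dn0) => h; apply/ltW/h.
  rewrite /ball_ /= sub0r normrN normrZ ger0_norm ?divr_ge0 // ?ltW //.
  rewrite (@le_lt_trans _ _ (d / 2)) //; last by rewrite ltr_pdivrMr // ltr_pMr // ltr1n.
  rewrite ger_pMr ?divr_gt0 // [leLHS]/Num.Def.normr/= mx_normrE bigmax_le // => -[i j] _ /=.
  by rewrite mxE /=; case: (_ && _); rewrite ?normr1 ?normr0.
move=> x Sx; have [[] [p [_ <-]]] := stereo_cover Sx; last exact: fa.
by have [->|p0] := eqVneq p 0; [exact: at0|exact: off].
Qed.

End SphereExtremum.

(** * Umbilical immersions of the sphere *)

Section UmbilicalSphere.
Variables (R : realType) (psi : 'rV[R]_3 -> 'rV[R]_4).
Hypothesis spacelike : spacelike_immersion (@unit_sphere2 R) psi.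
Hypothesis umbilical : totally_umbilical (@unit_sphere2 R) psi.
Hypothesis null_psi : psi @` @unit_sphere2 R `<=` @future_lightcone R.

Let X b := psi \o stereo b.

Let sX b : smooth_on setT (X b).
Proof. by case: (spacelike.1 _ _ (stereo_local_param R b)). Qed.

Let posX b : riemannian_on (X b) setT.
Proof. exact: (spacelike.2 _ _ (stereo_local_param R b)). Qed.

Let psi_null x : unit_sphere2 x -> lorentz (psi x) (psi x) = 0.
Proof. by move=> Sx; have [] : future_lightcone (psi x) by apply: null_psi; exists x. Qed.

Let XX b q : lorentz (X b q) (X b q) = 0.
Proof. exact: psi_null (stereo_sphere b q). Qed.

Let pairing_continuous (a : 'rV[R]_4) b :
  continuous ((fun x => lorentz a (psi x)) \o stereo b).
Proof.
move=> q; apply: differentiable_continuous.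
have -> : (fun x => lorentz a (psi x)) \o stereo b = fun p =>
    - a ord0 0 * X b p ord0 0 + a ord0 1 * X b p ord0 1
    + a ord0 2%:R * X b p ord0 2%:R + a ord0 3%:R * X b p ord0 3%:R.
  by apply/funext => p /=; rewrite lorentzE mulNr.
have d j (c : R) : differentiable (fun p => c * X b p ord0 j) q.
  apply: differentiableM => //.
  apply: (@differentiable_comp _ _ _ _ (X b) (fun z : 'rV[R]_4 => z ord0 j)).
    exact: (smooth_differentiable (sX b) (I : setT q)).
  exact: differentiable_coord.
by apply: differentiableD => //; apply: differentiableD => //; apply: differentiableD.
Qed.

(** The vector [c] comes from one chart only; extending the equation to the pole by continuity
    avoids matching constants found in two charts. *)
Lemma sphere_slice : exists (c : 'rV[R]_4) (k : R), lorentz c c = - k /\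
  forall x, unit_sphere2 x -> lorentz c (psi x) = -1.
Proof.
have IIH q v w : second_form (X false) q v w =
    lorentz (dird v (X false) q) (dird w (X false) q) *: mean_curvature_vec (X false) q.
  by rewrite -induced_metricE; exact: (umbilical (stereo_local_param R false)).
have [c [k [cc cX]]] := umbilical_slice (sX false) (posX false) (XX false) IIH.
exists c, k; split=> //.
by apply: sphere_eq_of_chart => //; exact: pairing_continuous.
Qed.

Section Slice.
Variables (c : 'rV[R]_4) (k : R).
Hypothesis cc : lorentz c c = - k.
Hypothesis cpsi : forall x, unit_sphere2 x -> lorentz c (psi x) = -1.

Let XX' b q : [set: 'rV[R]_2] q -> lorentz (X b q) (X b q) = 0.
Proof. by move=> _. Qed.
Let cX b q : [set: 'rV[R]_2] q -> lorentz c (X b q) = -1.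
Proof. by move=> _; apply: cpsi; exact: stereo_sphere. Qed.

Lemma pairing_max (a : 'rV[R]_4) : exists b p,
  (forall x, unit_sphere2 x -> lorentz a (psi x) <= lorentz a (X b p)) /\
  (forall i, lorentz a (dird (coord_vec R i) (X b) p) = 0).
Proof.
have [b [p h]] := sphere_max (@pairing_continuous a).
exists b, p; split=> // i; apply: critical_at_max => // q.
exact: h _ (stereo_sphere b q).
Qed.

Lemma slice_curvature_gt0 : 0 < k.
Proof.
have [//|k0] := ltP 0 k.
(* A purely spatial vector orthogonal to [c]: the first spatial axis if [c_1 = 0], otherwise
   [(c_1, c_2)] turned by a quarter. *)
have [a [ac aa]] : exists a : 'rV[R]_4, lorentz a c = 0 /\ 0 < lorentz a a.
  have [c1|c1] := eqVneq (c ord0 1) 0.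
    exists (delta_mx ord0 1); rewrite !lorentzE !mxE /= c1; split; lra.
  exists (\row_j (if j == 1 then c ord0 2%:R else if j == 2%:R then - c ord0 1 else 0)).
  rewrite !lorentzE !mxE /=; split; first by ring.
  have : 0 < c ord0 1 ^+ 2 by rewrite exprn_even_gt0.
  have := sqr_ge0 (c ord0 2%:R); rewrite !expr2; lra.
have [b [p [_ hp]]] := pairing_max a.
have := slice_critical_norm openT (sX b) (posX b) (XX' b) (cX b) cc (I : setT p) hp.
rewrite ac mulr0 mul0r subr0 => e; move: aa; rewrite e.
by rewrite ltNge mulr_le0_ge0 // sqr_ge0.
Qed.

Lemma slice_surjective (y : 'rV[R]_4) : lorentz y y = 0 -> lorentz c y = -1 ->
  exists2 x, unit_sphere2 x & psi x = y.
Proof.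
move=> yy cy; have k0 := slice_curvature_gt0.
have crit b p : (forall i, lorentz y (dird (coord_vec R i) (X b) p) = 0) ->
    y = (k * lorentz y (X b p) + 1) *: X b p - lorentz y (X b p) *: c.
  move=> hp.
  have := slice_critical openT (sX b) (posX b) (XX' b) (cX b) cc (I : setT p) hp.
  by rewrite (lorentzC y c) cy opprK.
have norm b p : (forall i, lorentz y (dird (coord_vec R i) (X b) p) = 0) ->
    lorentz y (X b p) = 0 \/ k * lorentz y (X b p) = - 2.
  move=> hp.
  have := slice_critical_norm openT (sX b) (posX b) (XX' b) (cX b) cc (I : setT p) hp.
  rewrite yy (lorentzC y c) cy; move: (lorentz y (X b p)) => m e.
  have /eqP : m * (k * m + 2) = 0 by lra.
  by rewrite mulf_eq0 => /orP[/eqP|/eqP h]; [left|right; lra].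
have [b [p [hmax hp]]] := pairing_max y.
have [m0|mk] := norm b p hp.
  exists (stereo b p); first exact: stereo_sphere.
  by rewrite [RHS](crit b p hp) m0 mulr0 add0r scale1r scale0r subr0.
exfalso.
(* The maximum of [<y, psi>] is now [- 2 / k]. Its minimum, found as the maximum of [<- y, psi>], is
   also a critical value; it cannot be 0, which is larger than [- 2 / k]. So [<y, psi>] is constant
   and every point is critical; [crit] then makes [X false] constant, against the positivity of the
   metric. *)
have [b' [p' [hmin hp']]] := pairing_max (- y).
have {}hp' i : lorentz y (dird (coord_vec R i) (X b') p') = 0.
  by apply/eqP; rewrite -oppr_eq0 -lorentzNl; apply/eqP.
have le_m := hmax _ (stereo_sphere b' p').
have kn0 : k != 0 by rewrite gt_eqF.
have m'E : lorentz y (X b' p') = lorentz y (X b p).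
  have [m0|mk'] := norm b' p' hp'; last by apply: (mulfI kn0); rewrite mk mk'.
  have : k * lorentz y (X b' p') <= k * lorentz y (X b p) by rewrite ler_pM2l.
  rewrite mk m0 mulr0; lra.
have cst q : lorentz (X false q) y = lorentz y (X b p).
  rewrite lorentzC; apply/eqP; rewrite eq_le (hmax _ (stereo_sphere false q)) /=.
  by have := hmin _ (stereo_sphere false q); rewrite !lorentzNl lerN2 m'E.
have crit_all q i : lorentz y (dird (coord_vec R i) (X false) q) = 0.
  have d := is_derive_lorentz_cst y (smooth_is_dird (coord_vec R i) (sX false) (I : setT q)).
  by rewrite lorentzC; apply: (is_derive_cst_on openT (I : setT q) _ d) => z _; exact: cst.
have X_cst q : X false q = - (y + lorentz y (X b p) *: c).
  have := crit false q (crit_all q); rewrite (lorentzC y (X false q)) cst mk.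
  have -> : -2 + 1 = -1 :> R by lra.
  rewrite scaleN1r; move: (lorentz y (X b p)) => m e.
  by rewrite [in RHS]e subrK opprK.
have := metric00_gt0 (posX false) (I : setT 0).
have d := smooth_is_dird (coord_vec R 0) (sX false) (I : setT 0).
by rewrite (is_derive_cst_on openT (I : setT 0) (fun q _ => X_cst q) d) lorentz0l ltxx.
Qed.

(** This puts [u], a negative multiple of [c], in the past. A past timelike [c] would pair
    positively with the future null vector [psi x], whereas the pairing is -1. *)
Lemma slice_time_gt0 : 0 < c ord0 0.
Proof.
have k0 := slice_curvature_gt0.
have Sx := stereo_sphere false (0 : 'rV[R]_2).
have [xx x0] : future_lightcone (psi (stereo false 0)).
  by apply: null_psi; exists (stereo false 0).
have cx := cpsi Sx.
have [//|c0] := ltP 0 (c ord0 0).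
have c0n : c ord0 0 != 0.
  apply/negP => /eqP e; move: cc; rewrite lorentzE e.
  have := sqr_ge0 (c ord0 1); have := sqr_ge0 (c ord0 2%:R); have := sqr_ge0 (c ord0 3%:R).
  rewrite !expr2; lra.
have cneg : c ord0 0 < 0 by rewrite lt_neqAle c0n.
have : 0 < lorentz c (psi (stereo false 0)).
  rewrite past_timelike_null_sign ?gt_eqF //; rewrite cc; lra.
by rewrite cx; lra.
Qed.

Lemma slice_constant_curvature : constant_gauss_curvature (@unit_sphere2 R) psi k.
Proof.
move=> U phi Hphi p Up; have [oU _ _ _ _] := Hphi.
have [sphi _] := spacelike.1 _ _ Hphi.
have psi0 q : U q -> lorentz ((psi \o phi) q) ((psi \o phi) q) = 0.
  by move=> Uq; apply: psi_null; exact: local_param_mem Hphi Uq.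
have psic q : U q -> lorentz c ((psi \o phi) q) = -1.
  by move=> Uq; apply: cpsi; exact: local_param_mem Hphi Uq.
exact: (slice_gauss_curvature oU sphi (spacelike.2 _ _ Hphi) psi0 psic cc Up).
Qed.

End Slice.

Lemma umbilical_sphere_image : exists (u : 'rV[R]_4) (r : R),
  [/\ lorentz u u = -1, u ord0 ord0 < 0, 0 < r,
      psi @` @unit_sphere2 R = lightcone_sphere u r &
      constant_gauss_curvature (@unit_sphere2 R) psi (1 / r ^+ 2)].
Proof.
have [c [k [cc cpsi]]] := sphere_slice.
have k0 := slice_curvature_gt0 cc cpsi.
have s0 : 0 < Num.sqrt k by rewrite sqrtr_gt0.
have sn0 : Num.sqrt k != 0 by rewrite gt_eqF.
have sk : Num.sqrt k ^+ 2 = k by rewrite sqr_sqrtr // ltW.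
have rk : 1 / (Num.sqrt k)^-1 ^+ 2 = k by rewrite exprVn sk invrK mul1r.
(* These values solve [k = 1 / r^2] and [c = - u / r]. *)
exists (- (Num.sqrt k)^-1 *: c), (Num.sqrt k)^-1; split.
- by rewrite lorentzZl lorentzZr cc -{3}sk; field.
- by rewrite mxE mulNr oppr_lt0 mulr_gt0 ?invr_gt0 // (slice_time_gt0 cc cpsi).
- by rewrite invr_gt0.
- apply/seteqP; split=> [_ [x Sx <-]|y [yy cy]].
    by split; [exact: psi_null|rewrite lorentzZl cpsi // mulNr mulrN1 opprK].
  have {}cy : lorentz c y = -1.
    apply: (@mulfI _ (- (Num.sqrt k)^-1)); first by rewrite oppr_eq0 invr_eq0.
    by rewrite mulNr -mulNr -lorentzZl cy mulrN1 opprK.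
  by have [x Sx <-] := slice_surjective cc cpsi yy cy; exists x.
- by rewrite rk; exact: slice_constant_curvature cc cpsi.
Qed.

End UmbilicalSphere.

Theorem mainTheorem10 (R : realType) :
  (forall (u : 'rV[R]_4) (r : R),
     lorentz u u = -1 -> u ord0 ord0 < 0 -> 0 < r ->
     [/\ regular_surface (lightcone_sphere u r),
         spacelike_immersion (lightcone_sphere u r) id,
         totally_umbilical (lightcone_sphere u r) id,
         lightcone_sphere u r `<=` @future_lightcone R &
         constant_gauss_curvature (lightcone_sphere u r) id (1 / r ^+ 2)]) /\
  (forall psi : 'rV[R]_3 -> 'rV[R]_4,
     spacelike_immersion (@unit_sphere2 R) psi ->
     totally_umbilical (@unit_sphere2 R) psi ->
     psi @` @unit_sphere2 R `<=` @future_lightcone R ->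
     exists (u : 'rV[R]_4) (r : R),
       [/\ lorentz u u = -1, u ord0 ord0 < 0, 0 < r,
           psi @` @unit_sphere2 R = lightcone_sphere u r &
           constant_gauss_curvature (@unit_sphere2 R) psi (1 / r ^+ 2)]).
Proof.
split=> [u r uu u0 r0|psi]; last exact: umbilical_sphere_image.
split.
- exact: lightcone_sphere_regular.
- split=> U phi Hphi; first by have [_ sphi iphi _ _] := Hphi.
  exact: lightcone_sphere_riemannian Hphi.
- by move=> U phi Hphi; exact: lightcone_sphere_umbilical Hphi.
- exact: lightcone_sphere_future.
- by move=> U phi Hphi p Up; exact: (lightcone_sphere_gauss uu u0 r0 Hphi Up).
Qed.
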